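(* Consider the narrow wedge initial data $\mathfrak h_0^\vee$, i.e. $\mathfrak h_0^\vee(y)=0$ if $y=0$ and $\mathfrak h_0^\vee(y)=-\infty$ otherwise (on $\mathbb R$, respectively on $\mathbb T$). As $\varepsilon\to0$, we have convergence, as a process in $y\in\mathbb R$ and $t\ge0$, of $$\varepsilon^{-1/3}\,\mathfrak h^{\mathrm{per}}\big(\mathfrak h_0^\vee;y\varepsilon^{2/3},t\varepsilon\big)\ \longrightarrow\ \mathfrak h(\mathfrak h_0^\vee;y,t),$$ where $\mathfrak h^{\mathrm{per}}$ is the periodic KPZ fixed point and $\mathfrak h$ the full-space KPZ fixed point.
   Context: **Fixed points.** $\mathbb T=\mathbb R/\mathbb Z$. $\mathfrak h(\mathfrak h_0;y,t)=\sup_{x\in\mathbb R}(\mathfrak h_0(x)+\mathcal L(x,0;y,t))$ and $\mathfrak h^{\mathrm{per}}(\mathfrak h_0;y,t)=\sup_{x\in\mathbb T}(\mathfrak h_0(x)+\mathcal L^{\mathrm{per}}(x,0;y,t))$ for $t>0$, and both equal the initial data at $t=0$ (spatial arguments of $\mathfrak h^{\mathrm{per}}$ are read mod $1$). Convergence is in distribution. **Directed landscapes.** $\mathbb R^4_\uparrow=\{(x,s;y,t)\in\mathbb R^4:s<t\}$. The (full-space) directed landscape $\mathcal L$ is the Dauvergne–Ortmann–Virág directed landscape: the random continuous function on $\mathbb R^4_\uparrow$ (unique in law) with independent increments over disjoint time intervals, increments $\mathcal L(\cdot,t;\cdot,t+s^3)$ distributed as an Airy sheet of scale $s$ (normalised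 so that $\mathcal L(x,s;y,t)+(x-y)^2/(t-s)$ is stationary and $\mathcal L(0,0;0,1)$ is GUE Tracy–Widom), and $\mathcal L(x,s;y,t)=\sup_z(\mathcal L(x,s;z,r)+\mathcal L(z,r;y,t))$ for $s<r<t$. The periodic directed landscape $\mathcal L^{\mathrm{per}}$ is the random continuous function on $(\mathbb T\times[0,1])^2_\uparrow=\{(x,s;y,t)\in(\mathbb T\times[0,1])^2:s<t\}$, unique in law, such that: (i') for some $r'\in(0,1)$, $\alpha'>2$, $C'>0$, for all $\varepsilon\in(0,1]$, $a\in\mathbb T$, $b\in[0,1-\varepsilon]$, the total variation distance between the laws of $\mathcal L^{\mathrm{per}}$ (space taken mod $1$) and $\mathcal L$ restricted to pairs of points $(x,s),(y,t)\in[a,a+r']\times[b,b+\varepsilon]$ with $s<t$ is at most $C'\varepsilon^{\alpha'}$; (ii) increments over disjoint time intervals are independent; (iii) almost surely $\mathcal L^{\mathrm{per}}(x,s;y,t)=\sup_{z\in\mathbb T}(\mathcal L^{\mathrm{per}}(x,s;z,r)+\mathcal L^{\mathrm{per}}(z,r;y,t))$ for all $s<r<t$, $x,y\in\mathbb T$. It is extended to $(\mathbb T\times\mathbb R)^2_\uparrow$ by using independent copies on successive unit time intervals and metric composition. *)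

(* Defs.v *)
From HB Require Import structures.
From mathcomp Require Export all_boot all_order all_algebra.
From mathcomp Require Export all_classical all_reals all_analysis.
From mathcomp Require Export measurable_realfun.
Set Implicit Arguments.
Unset Strict Implicit.
Unset Printing Implicit Defensive.
Export Order.TTheory GRing.Theory Num.Theory numFieldNormedType.Exports.
Local Open Scope classical_set_scope.
Local Open Scope ring_scope.

(* A random field indexed by I is a map X : T -> (I -> V); its law on D `<=` I
   is the law of the restriction of its paths to D, a probability on the
   sigma-algebra generated by the evaluations at the points of D. *)

Definition cylinder (I : Type) (d : measure_display) (V : measurableType d)
    (D : set I) : set (set (I -> V)) :=
  [set A | exists i (B : set V),
     [/\ D i, measurable B & A = [set f | B (f i)]]].

Definition path_sigma (I : Type) (d : measure_display) (V : measurableType d)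
    (D : set I) : set (set (I -> V)) := <<s @cylinder I d V D >>.

Definition random_field (I : Type) (d0 d : measure_display)
    (T : measurableType d0) (V : measurableType d) (D : set I)
    (X : T -> I -> V) : Prop :=
  forall i, D i -> measurable_fun [set: T] (X ^~ i).

Definition random_continuous (R : realType) (I : topologicalType)
    (d0 : measure_display) (T : measurableType d0) (D : set I)
    (X : T -> I -> R) : Prop :=
  random_field D X /\ forall w, {within D, continuous (X w)}.

Definition eq_law (R : realType) (I : Type) (d1 d2 d : measure_display)
    (T1 : measurableType d1) (T2 : measurableType d2) (V : measurableType d)
    (D : set I) (P1 : probability T1 R) (X1 : T1 -> I -> V)
    (P2 : probability T2 R) (X2 : T2 -> I -> V) : Prop :=
  forall A, path_sigma D A -> P1 (X1 @^-1` A) = P2 (X2 @^-1` A).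

Definition tv_dist (R : realType) (I : Type) (d1 d2 d : measure_display)
    (T1 : measurableType d1) (T2 : measurableType d2) (V : measurableType d)
    (D : set I) (P1 : probability T1 R) (X1 : T1 -> I -> V)
    (P2 : probability T2 R) (X2 : T2 -> I -> V) : \bar R :=
  ereal_sup [set `| P1 (X1 @^-1` A) - P2 (X2 @^-1` A) |%E
            | A in @path_sigma I d V D].

Definition independent_fields (R : realType) (n : nat) (I : Type)
    (d0 d : measure_display) (T : measurableType d0) (V : measurableType d)
    (D : set I) (P : probability T R) (X : 'I_n -> T -> I -> V) : Prop :=
  forall A : 'I_n -> set (I -> V), (forall k, path_sigma D (A k)) ->
    P (\bigcap_(k in [set: 'I_n]) (X k @^-1` A k)) =
    (\prod_(k < n) P (X k @^-1` A k))%E.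

(* The improper integral (1/pi) \int_0^oo cos(u^3/3 + x u) du, which is only
   conditionally convergent. *)
Definition airy (R : realType) (x : R) : R :=
  pi^-1 * lim ((fun M : R =>
    \int[@lebesgue_measure R]_(u in `[0, M]) cos (u ^+ 3 / 3 + x * u))
    @ +oo).

Definition ext_airy_kernel (R : realType) (s x t y : R) : R :=
  if t <= s then
    \int[@lebesgue_measure R]_(l in `[0, +oo[)
      (expR (- l * (s - t)) * airy (x + l) * airy (y + l))
  else
    - \int[@lebesgue_measure R]_(l in `]-oo, 0])
      (expR (- l * (s - t)) * airy (x + l) * airy (y + l)).

Fixpoint iterated_integral (R : realType) (Bs : seq (set R))
    (F : seq R -> R) : R :=
  if Bs is B :: Bs' then
    \int[@lebesgue_measure R]_(x in B)
      iterated_integral Bs' (fun xs => F (x :: xs))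
  else F [::].

(* [A w i] is the line of index i + 1.  The last clause says that for all
   times the process of the points (t, A_i(t) + t^2) is determinantal with the
   extended Airy kernel: its joint intensities (n-th factorial moment measures,
   the time indices tau being allowed to repeat) are given by determinants. *)
Definition is_parabolic_airy_line_ensemble (R : realType)
    (d0 : measure_display) (T : measurableType d0) (P : probability T R)
    (A : T -> nat -> R -> R) : Prop :=
  [/\ forall i, random_continuous [set: R] (fun w => A w i),
      {ae P, forall w, forall i t, A w i.+1 t < A w i t} &
      forall (n : nat) (tau : 'I_n -> R) (B : 'I_n -> set R),
        (forall k, measurable (B k) /\ bounded_set (B k)) ->
        (\int[P]_w \esum_(i in [set i : {ffun 'I_n -> nat} |
              forall k l, k != l -> tau k = tau l -> i k != i l])
            (\prod_(k < n)
               \1_(B k) (A w (i k) (tau k) + tau k ^+ 2))%:E)%E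
        = (iterated_integral (codom B) (fun xs : seq R =>
             \det (\matrix_(k < n, l < n)
                ext_airy_kernel (tau k) xs`_k (tau l) xs`_l)))%:E].

(* The last passage value f[(a, k) -> (y, 1)] over the lines f_1, ..., f_k,
   f_(i+1) being [f i]; z i is the jump time from line i + 1 to line i. *)
Definition last_passage (R : realType) (f : nat -> R -> R) (a : R) (k : nat)
    (y : R) : R :=
  sup [set \sum_(i < k) (f i (z i) - f i (z i.+1)) | z in
        [set z : nat -> R | [/\ z 0%N = y, z k = a &
           forall i : nat, (i < k)%N -> z i.+1 <= z i]]].

(* The Airy sheet of Dauvergne, Ortmann and Virag.  The existential space in
   the last clause carries the coupling with the line ensemble. *)
Definition is_airy_sheet (R : realType) (d0 : measure_display)
    (T : measurableType d0) (P : probability T R) (S : T -> R * R -> R) : Prop :=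
  [/\ random_continuous [set: R * R] S,
      forall c : R,
        eq_law [set: R * R] P S P (fun w p => S w (p.1 + c, p.2 + c)) &
      exists (d1 : measure_display) (T1 : measurableType d1)
        (P1 : probability T1 R) (S1 : T1 -> R * R -> R)
        (A : T1 -> nat -> R -> R),
        [/\ random_continuous [set: R * R] S1,
            eq_law [set: R * R] P S P1 S1,
            is_parabolic_airy_line_ensemble P1 A,
            {ae P1, forall w, forall y, S1 w (0, y) = A w 0%N y} &
            forall x y z : rat, 0 < x ->
              {ae P1, forall w, exists K : nat, forall k : nat, (K <= k)%N ->
                let xk : R := - Num.sqrt (k%:R / (2 * ratr x)) in
                last_passage (A w) xk k (ratr y) -
                last_passage (A w) xk k (ratr z) =
                S1 w (ratr x, ratr y) - S1 w (ratr x, ratr z)}]].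

(* A point (x, s; y, t) is represented by the tuple (x, s, y, t). *)
Definition R4up (R : realType) : set (R * R * R * R) :=
  [set p | p.1.1.2 < p.2].

Definition increment (R : realType) (d0 : measure_display)
    (T : measurableType d0) (L : T -> R * R * R * R -> R) (s t : R)
    (w : T) (p : R * R) : R := L w (p.1, s, p.2, t).

Definition independent_increments (R : realType) (d0 : measure_display)
    (T : measurableType d0) (J : set R) (P : probability T R)
    (L : T -> R * R * R * R -> R) : Prop :=
  forall (n : nat) (s t : 'I_n -> R),
    (forall k, [/\ J (s k), J (t k) & s k < t k]) ->
    (forall k l, k != l -> `]s k, t k[ `&` `]s l, t l[ = set0) ->
    independent_fields [set: R * R] P (fun k => increment L (s k) (t k)).

(* Space is Z; the time variables range over J. *)
Definition metric_composition (R : realType) (d0 : measure_display)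
    (T : measurableType d0) (Z J : set R) (P : probability T R)
    (L : T -> R * R * R * R -> R) : Prop :=
  {ae P, forall w, forall s r t x y, J s -> J r -> J t -> s < r -> r < t ->
    (L w (x, s, y, t))%:E =
    ereal_sup [set (L w (x, s, z, r) + L w (z, r, y, t))%:E | z in Z]}.

Definition is_directed_landscape (R : realType) (d0 : measure_display)
    (T : measurableType d0) (P : probability T R)
    (L : T -> R * R * R * R -> R) : Prop :=
  [/\ random_continuous (@R4up R) L,
      independent_increments [set: R] P L,
      exists (d1 : measure_display) (T1 : measurableType d1)
        (P1 : probability T1 R) (S : T1 -> R * R -> R),
        is_airy_sheet P1 S /\
        forall t s : R, 0 < s ->
          eq_law [set: R * R] P (increment L t (t + s ^+ 3))
            P1 (fun w p => s * S w (p.1 / s ^+ 2, p.2 / s ^+ 2)) &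
      metric_composition [set: R] [set: R] P L].

(* A function on the torus is represented by its 1-periodic lift to R; the
   torus itself is represented by `[0, 1[ when it indexes a supremum. *)

Definition torus (R : realType) : set R := `[0, 1[.

Definition space_periodic (R : realType) (D : set (R * R * R * R))
    (f : R * R * R * R -> R) : Prop :=
  forall x s y t, D (x, s, y, t) ->
    f (x + 1, s, y, t) = f (x, s, y, t) /\
    f (x, s, y + 1, t) = f (x, s, y, t).

Definition unit_up (R : realType) : set (R * R * R * R) :=
  [set p | [/\ 0 <= p.1.1.2, p.1.1.2 < p.2 & p.2 <= 1]].

Definition window (R : realType) (a r b e : R) : set (R * R * R * R) :=
  [set p | [/\ p.1.1.1 \in `[a, a + r], p.1.2 \in `[a, a + r],
               p.1.1.2 \in `[b, b + e], p.2 \in `[b, b + e] &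
               p.1.1.2 < p.2]].

(* The periodic directed landscape on the time interval [0, 1]; (P, L) is a
   directed landscape.  The base point a of the arc [a, a + r] of the torus
   ranges over all its representatives. *)
Definition is_unit_periodic_landscape (R : realType) (d0 d1 : measure_display)
    (T : measurableType d0) (P : probability T R)
    (L : T -> R * R * R * R -> R)
    (T1 : measurableType d1) (P1 : probability T1 R)
    (Lper : T1 -> R * R * R * R -> R) : Prop :=
  [/\ random_continuous (@unit_up R) Lper,
      forall w, space_periodic (@unit_up R) (Lper w),
      exists r alpha C : R,
        [/\ 0 < r < 1, 2 < alpha, 0 < C &
            forall e a b : R, 0 < e <= 1 -> 0 <= b <= 1 - e ->
              (tv_dist (window a r b e) P1 Lper P L <= (C * e `^ alpha)%:E)%E],
      independent_increments `[0, 1] P1 Lper &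
      metric_composition (@torus R) `[0, 1] P1 Lper].

Definition time_block (R : realType) (d0 : measure_display)
    (T : measurableType d0) (L : T -> R * R * R * R -> R) (m : int)
    (w : T) (p : R * R * R * R) : R :=
  L w (p.1.1.1, p.1.1.2 + m%:~R, p.1.2, p.2 + m%:~R).

(* The extension to all times: independent copies on the time intervals
   [m, m + 1], glued by metric composition. *)
Definition is_periodic_landscape (R : realType) (d0 d1 : measure_display)
    (T : measurableType d0) (P : probability T R)
    (L : T -> R * R * R * R -> R)
    (T1 : measurableType d1) (P1 : probability T1 R)
    (Lper : T1 -> R * R * R * R -> R) : Prop :=
  [/\ random_continuous (@R4up R) Lper /\
        (forall w, space_periodic (@R4up R) (Lper w)),
      is_unit_periodic_landscape P L P1 Lper,
      forall m : int,
        eq_law (@unit_up R) P1 (time_block Lper m) P1 Lper,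
      forall (n : nat) (m : 'I_n -> int), injective m ->
        independent_fields (@unit_up R) P1 (fun k => time_block Lper (m k)) &
      metric_composition (@torus R) [set: R] P1 Lper].

(* Only times t >= 0 are meaningful. *)
Definition fixed_point_on (R : realType) (Z : set R) (h0 : R -> \bar R)
    (L : R * R * R * R -> R) (y t : R) : \bar R :=
  if 0 < t then ereal_sup [set (h0 x + (L (x, 0, y, t)%R)%:E)%E | x in Z]
  else h0 y.

Definition kpz_fixed_point (R : realType) (h0 : R -> \bar R)
    (L : R * R * R * R -> R) (y t : R) : \bar R :=
  fixed_point_on [set: R] h0 L y t.

Definition periodic_kpz_fixed_point (R : realType) (h0 : R -> \bar R)
    (Lper : R * R * R * R -> R) (y t : R) : \bar R :=
  fixed_point_on (@torus R) h0 Lper y t.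

Definition narrow_wedge (R : realType) (y : R) : \bar R :=
  if y == 0 then 0%E else -oo%E.

Definition periodic_narrow_wedge (R : realType) (y : R) : \bar R :=
  if y \is a Num.int then 0%E else -oo%E.

Definition upper_half (R : realType) : set (R * R) := [set p | 0 <= p.2].

(* Paths (y, t) |-> h(y, t), with the topology of uniform convergence on the
   compact subsets of the closed half-plane t >= 0, for the uniform structure
   of the extended line (narrow wedge paths take the value -oo at t = 0).
   Values at t < 0 are invisible to this topology. *)
Definition path_space (R : realType) : topologicalType :=
  {family [set K : set (R * R) | compact K /\ K `<=` @upper_half R],
    (R * R)%type -> \bar R}.

(* Convergence in distribution as e tends to 0 from above.  Test functionals
   are also required to be measurable for the sigma-algebra of evaluations,
   so that their expectations make sense on this non-separable space. *)
Definition cvg_in_distribution (R : realType) (d0 d1 : measure_display)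
    (T1 : measurableType d1) (P1 : probability T1 R)
    (X : R -> T1 -> R * R -> \bar R)
    (T : measurableType d0) (P : probability T R)
    (Y : T -> R * R -> \bar R) : Prop :=
  forall F : path_space R -> R,
    continuous F ->
    (exists M : R, forall f, `|F f| <= M) ->
    (forall B : set R, measurable B ->
       path_sigma (@upper_half R) (F @^-1` B : set (R * R -> \bar R))) ->
    'E_P1[fun w => F (X e w)]%E @[e --> 0^'+] --> 'E_P[fun w => F (Y w)]%E.

(* Main.v *)
Require Import Defs.
From mathcomp Require Import all_boot all_order all_algebra.
From mathcomp Require Import all_classical all_reals all_analysis.
From mathcomp Require Import measurable_realfun.
From mathcomp Require Import ring lra.
Import Order.TTheory GRing.Theory Num.Theory numFieldNormedType.Exports.
Set Implicit Arguments.
Unset Strict Implicit.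
Unset Printing Implicit Defensive.
Local Open Scope classical_set_scope.
Local Open Scope ring_scope.

(* The laws of the periodic and full-space landscapes agree up to O(e^alpha) in
   total variation on windows of time length e.  With c = e^(1/3), a window of
   time length c already covers, after 1:2:3 rescaling, the sets
   |y| c^2 <= r/2, 0 <= t, t c^2 <= 1, which exhaust the half-plane as e -> 0,
   while the rescaled full-space fixed point has the same law as the unscaled
   one.  It remains to pass from these sets to the whole half-plane for a test
   functional F on a non-separable path space.  A superlevel set {F >= a} is
   exhausted in law by sets that are compact for the product topology; their
   projections to the coordinates of the n-th box are measurable, so their
   masses can be compared in total variation; and if a path f lies in
   infinitely many of these projections, it is the limit, uniformly on compact
   sets, of paths in {F >= a}, hence F f >= a.  So the mass of {F >= a} can only
   increase in the limit, and integrating over a for F and - F gives the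
   convergence of expectations. *)

(** * Laws of random fields *)

Section path_sigma_theory.
Context {I : Type} {d : measure_display} {V : measurableType d}.
Implicit Types D : set I.

Lemma path_sigma_cylinder D i (B : set V) :
  D i -> measurable B -> path_sigma D [set f : I -> V | B (f i)].
Proof. by move=> Di mB; apply: sub_sigma_algebra; exists i, B. Qed.

Lemma path_sigma_sigma_algebra D : sigma_algebra setT (@path_sigma I d V D).
Proof. exact: smallest_sigma_algebra. Qed.

Lemma path_sigmaS D D' :
  D `<=` D' -> @path_sigma I d V D `<=` @path_sigma I d V D'.
Proof.
move=> DD'; apply: sub_sigma_algebra2 => _ [i [B [Di mB ->]]].
by exists i, B; split=> //; exact: DD'.
Qed.

(** The sets that do not separate [f] from [g] form a sigma-algebra, and it contains every cylinder
    over a coordinate in [D]. *)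
Lemma path_sigma_saturated D (A : set (I -> V)) (f g : I -> V) :
  path_sigma D A -> (forall i, D i -> f i = g i) -> A f <-> A g.
Proof.
move=> sA fg.
pose S := [set A : set (I -> V) | A f <-> A g].
suff : path_sigma D `<=` S by apply.
apply: smallest_sub.
  split=> [//|B|B].
    by rewrite /S setTD /= => -[h1 h2]; split=> h ?; apply: h; tauto.
  by move=> SB; split=> -[n _ Bn]; exists n => //; exact/(SB n).
by move=> _ [i [B [Di mB ->]]]; rewrite /S /= fg.
Qed.

(** The target sigma-algebra is arbitrary, so that the same argument serves for the measurable sets
    of a probability space and for [path_sigma] itself. *)
Lemma path_sigma_preimage (Omega : Type) (S : set (set Omega))
    (X : Omega -> I -> V) D : sigma_algebra setT S ->
  (forall i B, D i -> measurable B -> S [set w | B (X w i)]) ->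
  forall A, path_sigma D A -> S (X @^-1` A).
Proof.
move=> sS SX; suff : path_sigma D `<=` [set A | S (X @^-1` A)] by [].
apply: smallest_sub => [|_ [i [B [Di mB ->]]]]; last exact: SX.
case: sS => S0 SC SU; split; first by rewrite /= preimage_set0.
  by move=> A /SC; rewrite !setTD.
by move=> A /SU; rewrite -preimage_bigcup.
Qed.

Lemma path_sigma_comp (J : Type) (d' : measure_display)
    (W : measurableType d') (E : set J) D (G : (J -> W) -> I -> V) :
  (forall i B, D i -> measurable B -> path_sigma E [set f | B (G f i)]) ->
  forall A, path_sigma D A -> path_sigma E (G @^-1` A).
Proof. by move=> h; apply: path_sigma_preimage => //; exact: smallest_sigma_algebra. Qed.

Lemma random_field_measurable (d0 : measure_display) (T : measurableType d0)
    D (X : T -> I -> V) : random_field D X ->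
  forall A, path_sigma D A -> measurable (X @^-1` A).
Proof.
move=> rX; apply: path_sigma_preimage; first exact: sigma_algebra_measurable.
by move=> i B Di mB; have := rX i Di measurableT B mB; rewrite setTI.
Qed.

End path_sigma_theory.

Lemma eq_law_comp (R : realType) (I J : Type) (d1 d2 d d' : measure_display)
    (T1 : measurableType d1) (T2 : measurableType d2) (V : measurableType d)
    (W : measurableType d') (D : set I) (E : set J)
    (P1 : probability T1 R) (X1 : T1 -> I -> V)
    (P2 : probability T2 R) (X2 : T2 -> I -> V) (G : (I -> V) -> J -> W) :
  (forall j B, E j -> measurable B -> path_sigma D [set f | B (G f j)]) ->
  eq_law D P1 X1 P2 X2 ->
  eq_law E P1 (G \o X1) P2 (G \o X2).
Proof.
move=> mG X12 A sA.
exact: (X12 _ (path_sigma_comp mG sA)).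
Qed.

(** Dynkin's argument: the sets on which the two image measures agree form a lambda-system. [Omega]
    is a bare type, so the generator [G] can be adapted to each use. *)
Lemma probability_pi_lambda (R : realType) (Omega : Type)
    (d1 d2 : measure_display)
    (T1 : measurableType d1) (T2 : measurableType d2)
    (P1 : probability T1 R) (X1 : T1 -> Omega)
    (P2 : probability T2 R) (X2 : T2 -> Omega) (G : set (set Omega)) :
  setI_closed G ->
  (forall A, G A -> measurable (X1 @^-1` A)) ->
  (forall A, G A -> measurable (X2 @^-1` A)) ->
  (forall A, G A -> P1 (X1 @^-1` A) = P2 (X2 @^-1` A)) ->
  forall A, <<s G>> A -> P1 (X1 @^-1` A) = P2 (X2 @^-1` A).
Proof.
move=> GI m1 m2 e12.
pose H := [set A | [/\ measurable (X1 @^-1` A), measurable (X2 @^-1` A) &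
  P1 (X1 @^-1` A) = P2 (X2 @^-1` A)]].
suff : <<s G>> `<=` H by move=> GH A /GH[].
apply: lambda_system_subset => //; last by move=> A GA; split; auto.
apply/dynkin_lambda_system; split.
- by split; rewrite preimage_setT// !probability_setT.
- move=> A [mA1 mA2 eA]; split; rewrite preimage_setC; try exact: measurableC.
  by rewrite preimage_setC !probability_setC// eA.
- move=> F tF HF; split; rewrite preimage_bigcup.
  + by apply: bigcup_measurable => k _; case: (HF k).
  + by apply: bigcup_measurable => k _; case: (HF k).
  + rewrite preimage_bigcup !measure_bigcup//.
    * by apply: eq_eseriesr => k _; case: (HF k).
    * by move=> k _; case: (HF k).
    * by move=> i j _ _ [w [/= Fi Fj]]; apply: tF => //; eexists; split; [exact: Fi|exact: Fj].
    * by move=> k _; case: (HF k).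
    * by move=> i j _ _ [w [/= Fi Fj]]; apply: tF => //; eexists; split; [exact: Fi|exact: Fj].
Qed.

(** Product events form a pi-system whose sigma-algebra contains the joint cylinders, and
    independence factors their probabilities into those of the single fields. *)
Lemma eq_law_joint (R : realType) (I : Type) (d1 d2 d : measure_display)
    (T1 : measurableType d1) (T2 : measurableType d2) (V : measurableType d)
    (D : set I) (P1 : probability T1 R) (P2 : probability T2 R) (n : nat)
    (X1 : nat -> T1 -> I -> V) (X2 : nat -> T2 -> I -> V) :
  (forall k, (k < n)%N -> random_field D (X1 k)) ->
  (forall k, (k < n)%N -> random_field D (X2 k)) ->
  independent_fields D P1 (fun k : 'I_n => X1 k) ->
  independent_fields D P2 (fun k : 'I_n => X2 k) ->
  (forall k, (k < n)%N -> eq_law D P1 (X1 k) P2 (X2 k)) ->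
  eq_law [set q : nat * I | (q.1 < n)%N /\ D q.2]
    P1 (fun w q => X1 q.1 w q.2) P2 (fun w q => X2 q.1 w q.2).
Proof.
move=> r1 r2 i1 i2 e12 A.
pose prodset (E : nat -> set (I -> V)) :=
  [set f : nat * I -> V | forall k, (k < n)%N -> E k (fun i => f (k, i))].
pose G := [set B | exists2 E : nat -> set (I -> V),
  (forall k, (k < n)%N -> path_sigma D (E k)) & B = prodset E].
have preE (d0 : measure_display) (T : measurableType d0)
    (X : nat -> T -> I -> V) E : (fun w q => X q.1 w q.2) @^-1` prodset E =
    \bigcap_(k in [set: 'I_n]) (X k @^-1` E k).
  apply/seteqP; split=> w /= h; first by move=> k _; exact: h.
  by move=> k kn; exact: (h (Ordinal kn)).
have mpre (d0 : measure_display) (T : measurableType d0)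
    (X : nat -> T -> I -> V) : (forall k, (k < n)%N -> random_field D (X k)) ->
    forall B, G B -> measurable ((fun w q => X q.1 w q.2) @^-1` B).
  move=> rX _ [E sE ->]; rewrite preE; apply: fin_bigcap_measurable => // k _.
  by apply: (random_field_measurable (rX _ (ltn_ord k))); exact: sE.
suff sub : path_sigma [set q : nat * I | (q.1 < n)%N /\ D q.2] `<=` <<s G>>.
  move=> /sub; apply: probability_pi_lambda; [|exact: mpre|exact: mpre|].
    move=> _ _ [E sE ->] [E' sE' ->]; exists (fun k => E k `&` E' k).
      move=> k kn.
      pose Q := @path_sigma_sigma_algebra I d V D.
      have -> : E k `&` E' k = ~` (~` E k `|` ~` E' k).
        by rewrite setCU !setCK.
      case: Q => S0 SC SU; rewrite -setTD; apply: (SC); rewrite -bigcup2E.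
      apply: SU => -[|[|i]]; rewrite /bigcup2 /=; last exact: S0.
        by rewrite -setTD; apply: SC; exact: sE.
      by rewrite -setTD; apply: SC; exact: sE'.
    apply/seteqP; split=> [f [h h'] k kn|f h]; first by split; auto.
    by split=> k kn; case: (h k kn).
  move=> _ [E sE ->]; rewrite !preE i1; last by move=> k; exact: sE.
  rewrite i2; last by move=> k; exact: sE.
  by apply: eq_bigr => k _; apply: e12 => //; exact: sE.
apply: sub_sigma_algebra2 => _ [[k i] [B [/= [kn Di] mB ->]]].
(* A cylinder on the field [k] is the product event whose other factors are the whole space. *)
exists (fun j => if j == k then [set f | B (f i)] else setT).
  move=> j jn; case: eqP => _; first exact: path_sigma_cylinder.
  have [S0 SC _] := @path_sigma_sigma_algebra I d V D.
  by rewrite -setC0 -setTD; exact: SC.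
apply/seteqP; split=> f /=.
  by move=> Bf j jn; case: eqP => // ->.
by move=> /(_ _ kn); rewrite eqxx.
Qed.

(** * Inner regularity by compact sets of paths *)

(** The distance of the extended line is read through [contract], so its inverse [expand] is
    continuous on the segment from -1 to 1 and maps it onto the line. *)
Lemma compact_ereal (R : realType) : compact [set: \bar R].
Proof.
have in11 (x : R) : `[-1, 1]%classic x -> x \in [pred r : R | `|r| <= 1].
  by rewrite /= in_itv /= inE -ler_norml.
have -> : [set: \bar R] = (@expand R) @` `[-1, 1].
  apply/seteqP; split=> // x _; exists (contract x); last exact: contractK.
  by rewrite /= in_itv /= -ler_norml contract_le1.
apply: continuous_compact; last exact: segment_compact.
apply/subspace_continuousP => x x1; apply/cvg_ballP => e e0.
rewrite near_withinE; near=> y => y1.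
rewrite /ball /= /ereal_ball !expandK; [|exact: in11|exact: in11].
near: y; exact: (@cvgr_dist_lt _ _ _ (nbhs x) _ id x).
Unshelve. all: by end_near. Qed.

(** * Compact measurable sets of paths *)

Section compact_paving.
Context {R : realType} {X : eqType}.
Implicit Types (D K : set X) (A C : set (X -> \bar R)).

Definition rect (B : X -> set (\bar R)) : set (X -> \bar R) :=
  [set f | forall i, B i (f i)].

(** Finite unions of rectangles. The sides are closed, for compactness in the product topology, and
    Borel; together with the finite number of constrained coordinates this gives measurability
    although [X] may be uncountable. *)
Inductive elementary D : set (X -> \bar R) -> Prop :=
| elementary0 : elementary D set0
| elementaryU (B : X -> set (\bar R)) A : (forall i, closed (B i) /\ measurable (B i)) ->
    finite_set [set i | B i <> setT] -> [set i | B i <> setT] `<=` D ->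
    elementary D A -> elementary D (rect B `|` A).

(** The projection to the coordinates in [K] is kept as a cylinder in the full path space, so that
    it can be compared with events for [path_sigma K]. *)
Definition projection K C : set (X -> \bar R) :=
  [set f | exists2 g, C g & forall i, K i -> g i = f i].

Lemma elementary_rect D (B : X -> set (\bar R)) : (forall i, closed (B i) /\ measurable (B i)) ->
  finite_set [set i | B i <> setT] -> [set i | B i <> setT] `<=` D ->
  elementary D (rect B).
Proof.
move=> cB fB BD; rewrite -[rect B]setU0; apply: elementaryU => //.
exact: elementary0.
Qed.

Lemma elementaryT D : elementary D setT.
Proof.
have -> : [set: X -> \bar R] = rect (fun=> setT) by apply/seteqP.
apply: elementary_rect.
- by move=> i; split; [exact: closedT|exact: measurableT].
- by rewrite (_ : [set _ | _] = set0)//; apply/seteqP; split=> // i /=.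
- by move=> i /=.
Qed.

Lemma elementary_setU D A A' :
  elementary D A -> elementary D A' -> elementary D (A `|` A').
Proof.
by move=> + eA'; elim=> [|B A1 cB fB BD _ IH]; rewrite ?set0U// -setUA;
  exact: elementaryU.
Qed.

Lemma elementary_setI D A A' :
  elementary D A -> elementary D A' -> elementary D (A `&` A').
Proof.
move=> + eA'; elim=> [|B A1 cB fB BD _ IH].
  by rewrite set0I; exact: elementary0.
rewrite setIUl; apply: elementary_setU => //.
elim: eA' => [|B' A2 cB' fB' BD' _ IH'].
  by rewrite setI0; exact: elementary0.
rewrite setIUr; apply: elementary_setU => //.
have -> : rect B `&` rect B' = rect (fun i => B i `&` B' i).
  apply/seteqP; split=> [f [h h'] i|f h].
    by split; [exact: h|exact: h'].
  by split=> i; case: (h i).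
have sub : [set i | B i `&` B' i <> setT] `<=`
    [set i | B i <> setT] `|` [set i | B' i <> setT].
  move=> i /= h; apply: contrapT => /not_orP[/contrapT b /contrapT b'].
  by apply: h; rewrite b b' setIT.
apply: elementary_rect.
- move=> i; have [cBi mBi] := cB i; have [cBi' mBi'] := cB' i.
  by split; [exact: closedI|exact: measurableI].
- by apply: sub_finite_set sub _; rewrite finite_setU.
- by move=> i /sub[/BD|/BD'].
Qed.

Lemma elementary_measurable D A : elementary D A -> path_sigma D A.
Proof.
elim=> [|B A' cB fB BD _ IH]; first exact: sigma_algebra0.
pose T0 := g_sigma_algebraType (@cylinder X _ (\bar R) D).
have -> : rect B `|` A' = (\bigcap_(i in [set i | B i <> setT])
    [set f | B i (f i)]) `|` A'.
  congr (_ `|` _); apply/seteqP; split=> [f h i _|f h i]; first exact: h.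
  have [BT|BT] := pselect (B i = setT); first by rewrite BT.
  exact: h.
apply: (@measurableU _ T0) => //; apply: (@fin_bigcap_measurable _ T0) => //.
by move=> i BT; apply: path_sigma_cylinder; [exact: BD|exact: (cB i).2].
Qed.

Lemma rect_closed (B : X -> set (\bar R)) : (forall i, closed (B i)) ->
  closed (rect B : set (prod_topology (fun _ : X => \bar R))).
Proof.
move=> cB.
have -> : rect B = \bigcap_(i in setT)
    (@proj X (fun _ : X => \bar R) i @^-1` B i).
  by apply/seteqP; split=> [f h i _|f h i]; [exact: h|exact: (h i)].
apply: closed_bigI => i _; apply: closed_comp => // f _.
exact: proj_continuous.
Qed.

Lemma elementary_closed D A : elementary D A ->
  closed (A : set (prod_topology (fun _ : X => \bar R))).
Proof.
elim=> [|B A' cB _ _ _ IH]; first exact: closed0.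
by apply: closedU => //; apply: rect_closed => i; case: (cB i).
Qed.

Lemma elementary_projection D K A : elementary D A ->
  elementary K (projection K A).
Proof.
elim=> [|B A' cB fB BD _ IH].
  rewrite (_ : projection _ _ = set0); first exact: elementary0.
  by apply/seteqP; split=> // f [].
have -> : projection K (rect B `|` A') =
    projection K (rect B) `|` projection K A'.
  apply/seteqP; split=> [f [g [Bg|Ag] gf]|f [|] [g Bg gf]].
  - by left; exists g.
  - by right; exists g.
  - by exists g => //; left.
  - by exists g => //; right.
apply: elementary_setU => //.
(* A nonempty rectangle projects by dropping its constraints outside [K]: a point [f0] of it fills
   those coordinates. An empty one projects to the empty set and is treated apart. *)
have [[f0 Bf0]|nB] := pselect (rect B !=set0); last first.
  rewrite (_ : projection _ _ = set0); first exact: elementary0.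
  by apply/seteqP; split=> // f [g Bg]; case: nB; exists g.
pose B' i := if pselect (K i) then B i else setT.
have -> : projection K (rect B) = rect B'.
  apply/seteqP; split=> [f [g Bg gf] i|f Bf].
    by rewrite /B'; case: pselect => // Ki; rewrite -gf.
  exists (fun i => if pselect (K i) then f i else f0 i).
    move=> i; case: pselect => Ki; last exact: Bf0.
    by have := Bf i; rewrite /B'; case: pselect.
  by move=> i Ki; case: pselect.
have sub : [set i | B' i <> setT] `<=` [set i | B i <> setT] `&` K.
  by move=> i; rewrite /B' /=; case: pselect.
apply: elementary_rect.
- move=> i; rewrite /B'; case: pselect => Ki; first exact: cB.
  by split; [exact: closedT|exact: measurableT].
- by apply: sub_finite_set fB => i /sub[].
- by move=> i /sub[].
Qed.

Definition compact_paving D C := exists2 A : nat -> set (X -> \bar R),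
  (forall n, elementary D (A n)) /\ (forall m n, (m <= n)%N -> A n `<=` A m) &
  C = \bigcap_n A n.

Lemma compact_paving_elementary D A : elementary D A -> compact_paving D A.
Proof.
move=> eA; exists (fun=> A); first by split=> // m n _ f.
by apply/seteqP; split=> [f Af n _ //|f Af]; exact: (Af 0%N).
Qed.

Lemma compact_paving_measurable D C : compact_paving D C -> path_sigma D C.
Proof.
move=> [A [eA _] ->].
apply: (@bigcapT_measurable _ (g_sigma_algebraType (@cylinder X _ (\bar R) D))).
by move=> n; exact: elementary_measurable.
Qed.

Lemma compact_paving_setU D C C' : compact_paving D C -> compact_paving D C' ->
  compact_paving D (C `|` C').
Proof.
move=> [A [eA ndA] ->] [A' [eA' ndA'] ->].
exists (fun n => A n `|` A' n).
  split=> [n|m n mn]; first exact: elementary_setU.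
  by apply: setUSS; [exact: ndA|exact: ndA'].
apply/seteqP; split=> [f [] h n _|f h]; [left|right|]; try exact: h.
(* A path missing [A m] and [A' m'] misses both families at the larger index, by monotonicity. *)
apply: contrapT => /not_orP[].
move=> /existsNP[m /not_implyP[_ nm]] /existsNP[m' /not_implyP[_ nm']].
have [/(ndA _ _ (leq_maxl m m'))|/(ndA' _ _ (leq_maxr m m'))] :=
  h (maxn m m') I; by [].
Qed.

(** Diagonal argument: the n-th elementary set intersects the n-th approximations of the first n + 1
    sets, which keeps the sequence decreasing. *)
Lemma compact_paving_bigcap D (C : nat -> set (X -> \bar R)) :
  (forall k, compact_paving D (C k)) -> compact_paving D (\bigcap_k C k).
Proof.
move=> /(_ _)/cid2-/all_sig2[A eA CA].
have eA1 k n : elementary D (A k n) by case: (eA k).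
have eA2 k m n : (m <= n)%N -> A k n `<=` A k m by case: (eA k) => _; exact.
exists (fun n => \big[setI/setT]_(k < n.+1) A k n).
  split=> [n|m n mn f].
    apply: (big_ind (elementary D)) => //; first exact: elementaryT.
    exact: elementary_setI.
  rewrite -(bigcap_mkord _ (A ^~ n)) -(bigcap_mkord _ (A ^~ m)) => h k /= km; apply: (eA2 _ _ _ mn).
  by apply: h => /=; exact: leq_trans km _.
apply/seteqP; split=> [f h n _|f h k _].
  rewrite -(bigcap_mkord _ (A ^~ n)) => k _.
  by have := h k I; rewrite CA; exact.
rewrite CA => n _; apply: (eA2 k n _ (leq_maxr k n)).
have := h (maxn k n) I; rewrite -(bigcap_mkord _ (A ^~ (maxn k n))); apply => /=.
by rewrite ltnS leq_maxl.
Qed.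

(* Tychonoff: decreasing intersections of compact sets commute with
   projections. *)
Lemma compact_paving_projection D K C : compact_paving D C ->
  path_sigma K (projection K C).
Proof.
move=> [A [eA ndA] ->].
have -> : projection K (\bigcap_n A n) = \bigcap_n projection K (A n).
  apply/seteqP; split=> [f [g Ag gf] n _|f h]; first by exists g => //; exact: Ag.
  have /(_ _)/cid2-/all_sig2[g Ag gf] : forall n, exists2 g, A n g &
    forall i, K i -> g i = f i by move=> n; exact: h.
  pose T := prod_topology (fun _ : X => \bar R).
  have cT : compact [set: T].
    have -> : [set: T] = [set f : T | forall i, [set: \bar R] (f i)].
      by apply/seteqP.
    apply: (@tychonoff X (fun=> \bar R) (fun=> setT)) => _.
    exact: compact_ereal.
  (* A cluster point [p] lies in every closed set containing a tail of [g]. It is therefore in every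
     [A n], and it still agrees with [f] on [K]. *)
  have [p [_ gp]] : [set: T] `&` cluster ((g : nat -> T) @ \oo) !=set0.
    by apply: cT; exact: filterT.
  have pcl (E : set T) n : closed E -> (forall m, (n <= m)%N -> E (g m)) -> E p.
    move=> cE Eg; apply: cE => U pU; apply: gp => //.
    by exists n => // m /= nm; exact: Eg.
  exists p.
    move=> n _; apply: (pcl _ n); first exact: elementary_closed.
    by move=> m nm; apply: ndA (Ag m).
  move=> i Ki.
  apply: (pcl [set q : T | q i = f i] 0%N) => [|m _]; last exact: gf.
  apply: (@closed_comp T _ (@proj X (fun=> \bar R) i) [set f i]).
    by move=> q _; exact: proj_continuous.
  apply: accessible_closed_set1; apply: hausdorff_accessible.
  exact: ereal_hausdorff.
apply: (@bigcapT_measurable _ (g_sigma_algebraType (@cylinder X _ (\bar R) K))).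
by move=> n; apply: elementary_measurable; exact: (elementary_projection _ (eA n)).
Qed.

End compact_paving.

(** * Inner regularity of laws on path space *)

Section inner_regularity.
Context {R : realType} {X : eqType} (D : set X).
Let V := \bar R.
Let T0 := g_sigma_algebraType (@cylinder X _ V D).
Variable Q : probability T0 R.

Let regular (A : set T0) := measurable A /\ forall eta : R, 0 < eta ->
  exists C, [/\ compact_paving D C, C `<=` A & (Q (A `\` C) <= eta%:E)%E].

Let regular_paving A : compact_paving D A -> regular A.
Proof.
move=> pA; split; first exact: compact_paving_measurable.
move=> eta eta0; exists A; split=> //.
by rewrite setDv measure0 lee_fin ltW.
Qed.

Let regular_setU A B : regular A -> regular B -> regular (A `|` B).
Proof.
move=> [mA rA] [mB rB]; split; first exact: measurableU.
move=> eta eta0; have eta2 : 0 < eta / 2 by rewrite divr_gt0.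
have [C [pC CA QC]] := rA _ eta2; have [E [pE EB QE]] := rB _ eta2.
have mC : measurable (C : set T0) by exact: compact_paving_measurable.
have mE : measurable (E : set T0) by exact: compact_paving_measurable.
exists (C `|` E); split; [exact: compact_paving_setU|exact: setUSS|].
rewrite [eta]splitr EFinD (le_trans _ (leeD QC QE))//.
apply: le_trans (measureU2 _ _ _); try exact: measurableD.
apply: le_measure; rewrite ?inE.
- by apply: measurableD; exact: measurableU.
- by apply: measurableU; exact: measurableD.
- move=> w [[Aw|Bw] /not_orP[nC nE]]; [by left|by right].
Qed.

(** By continuity from above, some finite partial union misses at most mass eta / 2; the other half
    is spent on the regularity of that finite union. *)
Let regular_bigcup (A : nat -> set T0) :
  (forall k, regular (A k)) -> regular (\bigcup_k A k).
Proof.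
move=> rA.
have mA k : measurable (A k) by case: (rA k).
have mUA : measurable (\bigcup_k A k) by exact: bigcupT_measurable.
split=> // eta eta0; have eta2 : 0 < eta / 2 by rewrite divr_gt0.
pose U n := \big[setU/set0]_(k < n) A k.
have mU n : measurable (U n) by exact: bigsetU_measurable.
have rU n : regular (U n).
  apply: (big_ind regular) => //; apply: regular_paving.
  by apply: compact_paving_elementary; exact: elementary0.
have : (Q \o (fun n => (\bigcup_k A k) `\` U n)) x @[x --> \oo] -->
    Q (\bigcap_n ((\bigcup_k A k) `\` U n)).
  apply: nonincreasing_cvg_mu.
  - by rewrite (le_lt_trans (probability_le1 _ _)) ?ltry//; exact: measurableD.
  - by move=> n; exact: measurableD.
  - by apply: bigcapT_measurable => n; exact: measurableD.
  - move=> m n mn; apply/subsetPset; apply: setDS.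
    exact: subset_bigsetU.
have -> : \bigcap_n ((\bigcup_k A k) `\` U n) = set0.
  apply/seteqP; split=> // w h; have [[k _ Akw] _] := h 0%N I.
  have [_] := h k.+1 I; apply; rewrite /U -bigcup_mkord.
  by exists k => /=.
rewrite measure0 => /fine_cvgP[] _.
move=> /cvgrPdist_lt /(_ _ eta2)[N _ /(_ N (leqnn _))] /=.
rewrite sub0r normrN => QN.
have [C [pC CU QC]] := (rU N).2 _ eta2.
have mC : measurable (C : set T0) by exact: compact_paving_measurable.
exists C; split => //.
  apply: subset_trans CU _; rewrite /U -bigcup_mkord.
  exact: bigcup_subset.
rewrite [eta]splitr EFinD.
have QN' : (Q ((\bigcup_k A k) `\` U N) <= (eta / 2)%:E)%E.
  rewrite -[leLHS]fineK ?fin_num_measure//; last exact: measurableD.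
  by rewrite lee_fin (le_trans (ler_norm _))// ltW.
rewrite (le_trans _ (leeD QN' QC))//.
apply: le_trans (measureU2 _ _ _); try exact: measurableD.
apply: le_measure; rewrite ?inE.
- exact: measurableD.
- by apply: measurableU; exact: measurableD.
- by move=> w [Aw nC]; have [Uw|nU] := pselect (U N w); [right|left].
Qed.

(** The k-th set is approximated up to eta / 2^(k+1), and these errors sum to at most eta. *)
Let regular_bigcap (A : nat -> set T0) :
  (forall k, regular (A k)) -> regular (\bigcap_k A k).
Proof.
move=> rA.
have mA k : measurable (A k) by case: (rA k).
have mIA : measurable (\bigcap_k A k) by exact: bigcapT_measurable.
split=> // eta eta0.
have /(_ _)/cid-/all_sig[C pC] : forall k, exists C, [/\ compact_paving D C,
    C `<=` A k & (Q (A k `\` C) <= (eta / (2 ^ k.+1)%:R)%:E)%E].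
  by move=> k; apply: (rA k).2; rewrite divr_gt0// ltr0n expn_gt0.
have mC k : measurable (C k : set T0).
  by apply: compact_paving_measurable; case: (pC k).
exists (\bigcap_k C k); split.
- by apply: compact_paving_bigcap => k; case: (pC k).
- by move=> w Cw k _; case: (pC k) => _ + _; apply; exact: Cw.
- apply: le_trans (epsilon_trick0 predT (ltW eta0)).
  apply: (@le_trans _ _ (\sum_(0 <= k <oo) Q (A k `\` C k))%E).
    apply: measure_sigma_subadditive => //.
    + by move=> n; exact: measurableD.
    + by apply: measurableD => //; exact: bigcapT_measurable.
    + move=> w [Aw /existsNP[k /not_implyP[_ nC]]]; exists k => //.
      by split=> //; exact: Aw.
  by apply: lee_nneseries => // k _; case: (pC k).
Qed.

(** Regularity is not visibly stable under complement, so the good sets are those regular together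
    with their complement; countable unions and intersections then make them a sigma-algebra. *)
Lemma path_sigma_inner_regular (A : set T0) : path_sigma D A ->
  forall eta : R, 0 < eta ->
  exists C, [/\ compact_paving D C, C `<=` A & (Q (A `\` C) <= eta%:E)%E].
Proof.
suff sub : path_sigma D `<=` [set A : set T0 | regular A /\ regular (~` A)].
  by move=> /sub[[]].
have rT : regular setT.
  by apply/regular_paving/compact_paving_elementary; exact: elementaryT.
have r0 : regular set0.
  by apply/regular_paving/compact_paving_elementary; exact: elementary0.
have sS : sigma_algebra setT [set A : set T0 | regular A /\ regular (~` A)].
  split.
  - by rewrite /= setC0.
  - by move=> B [rB rCB]; rewrite setTD /= setCK.
  - move=> B rB; split; first by apply: regular_bigcup => k; case: (rB k).
    by rewrite setC_bigcup; apply: regular_bigcap => k; case: (rB k).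
apply: smallest_sub => // _ [i [B [Di mB ->]]].
pose Cyl := [set B : set V |
  [set A : set T0 | regular A /\ regular (~` A)] [set f | B (f i)]].
suff : measurable `<=` Cyl by exact.
rewrite [measurable](_ : _ = emeasurable (@ocitv R))//.
(* The Borel sets of the extended line are generated by the closed rays from a real r up to, and
   including, the point at infinity, so only these need be checked. *)
rewrite ErealGenCInfty.measurableE.
have ray_paving (E : set V) : closed E -> measurable E ->
    compact_paving D [set f | E (f i)].
  move=> cE mE; apply: compact_paving_elementary.
  pose B' j := if j == i then E else setT.
  have sub : [set j | B' j <> setT] `<=` [set i].
    by move=> j; rewrite /B' /=; case: eqP.
  have -> : [set f : X -> V | E (f i)] = rect B'.
    apply/seteqP; split=> [f Ef j|f /(_ i)]; rewrite /B' /= ?eqxx//.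
    by case: eqP => // ->.
  apply: elementary_rect.
  - move=> j; rewrite /B'; case: eqP => _; first by split.
    by split; [exact: closedT|exact: measurableT].
  - by apply: (sub_finite_set sub).
  - by move=> j /sub ->.
apply: smallest_sub => [|_ [r ->]].
  case: sS => S0 SC SU; split; first exact: S0.
    by move=> F FS; exact: (SC _ FS).
  by move=> F FS; exact: (SU _ FS).
split.
  apply/regular_paving/ray_paving; first by rewrite set_itvcy; exact: closed_ereal_le_ereal.
  exact: emeasurable_itv.
(* The complementary ray is open at r, hence is written as a countable union of closed rays ending
   at r - 1/(n+1). *)
have -> : ~` [set f : X -> V | `[r%:E, +oo[%classic (f i)] =
    \bigcup_n [set f : X -> V | `]-oo, (r - n.+1%:R^-1)%:E]%classic (f i)].
  apply/seteqP; split=> f /=; rewrite in_itv /= andbT; last first.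
    move=> [n _]; rewrite /= in_itv /= => fr; apply/negP; rewrite -ltNge.
    by rewrite (le_lt_trans fr)// lte_fin ltrBlDr ltrDl invr_gt0.
  move=> /negP; rewrite -ltNge; case fi : (f i) => [x| |]//; last first.
    by move=> _; exists 0%N => //; rewrite /= in_itv /= fi leNye.
  rewrite lte_fin => xr; have [n nxr] := ltr_add_invr xr.
  exists n => //; by rewrite /= in_itv /= fi lee_fin lerBrDr ltW.
apply: regular_bigcup => n.
apply/regular_paving/ray_paving; first exact: lray_closed.
exact: emeasurable_itv.
Qed.

End inner_regularity.

(** * Mass of closed events in the limit *)

Lemma inner_regular_preimage (R : realType) (X : eqType) (D : set X)
    (d : measure_display) (T : measurableType d) (P : probability T R)
    (F : T -> X -> \bar R) (A : set (X -> \bar R)) (eta : R) :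
  random_field D F -> path_sigma D A -> 0 < eta ->
  exists C, [/\ compact_paving D C, C `<=` A &
    (P (F @^-1` A) <= P (F @^-1` C) + eta%:E)%E].
Proof.
move=> rF sA eta0.
pose T0 := g_sigma_algebraType (@cylinder X _ (\bar R) D).
have mF : measurable_fun [set: T] (F : T -> T0).
  move=> _ B mB; rewrite setTI; exact: random_field_measurable rF B mB.
pose Fm : {mfun T >-> T0} := mfun_Sub (mem_set mF).
have [C [pC CA QC]] := path_sigma_inner_regular (distribution P Fm) sA eta0.
exists C; split=> //.
have mC : measurable (F @^-1` C).
  by apply: (random_field_measurable rF); exact: compact_paving_measurable.
have mA : measurable (F @^-1` A) by exact: (random_field_measurable rF).
have -> : F @^-1` A = F @^-1` C `|` (F @^-1` A `\` F @^-1` C).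
  by rewrite setDUK//; exact: preimage_subset.
apply: le_trans (measureU2 _ _ _) _ => //; first exact: measurableD.
by rewrite leeD2l.
Qed.

(* The n-th law of B is exhausted by compact sets, and their projections to
   K n are measurable, hence subject to the domination hypothesis. *)
Lemma limsup_law_closed (R : realType) (X : eqType) (D : set X)
    (d d' : measure_display) (T : measurableType d) (T' : measurableType d')
    (P : probability T R) (P' : probability T' R)
    (Y : T -> X -> \bar R) (F : nat -> T' -> X -> \bar R)
    (K : nat -> set X) (delta : nat -> R) (B : set (X -> \bar R)) :
  random_field D Y -> (forall n, random_field D (F n)) ->
  (forall n, K n `<=` D) ->
  delta n @[n --> \oo] --> (0 : R) ->
  (forall n A, path_sigma (K n) A ->
    (P' (F n @^-1` A) <= P (Y @^-1` A) + (delta n)%:E)%E) ->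
  path_sigma D B ->
  (forall f (g : nat -> X -> \bar R),
    (forall n i, K n i -> g n i = f i) ->
    (forall m, exists2 n, (m <= n)%N & B (g n)) -> B f) ->
  forall eta : R, 0 < eta ->
  \forall n \near \oo, (P' (F n @^-1` B) <= P (Y @^-1` B) + eta%:E)%E.
Proof.
move=> rY rF KD delta0 domK sB clB eta eta0.
(* The three thirds pay for inner regularity, for the domination error [delta n], and for continuity
   from above of [P] along [U]. *)
have eta3 : 0 < eta / 3 by rewrite divr_gt0.
have /(_ _)/cid-/all_sig[C pC] : forall n, exists C, [/\ compact_paving D C,
    C `<=` B & (P' (F n @^-1` B) <= P' (F n @^-1` C) + (eta / 3)%:E)%E].
  by move=> n; exact: (inner_regular_preimage P' (rF n) sB eta3).
pose A n := projection (K n) (C n).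
have sA n : path_sigma (K n) (A n).
  by apply: (@compact_paving_projection _ _ D); case: (pC n).
have mA n : measurable (Y @^-1` A n).
  by apply: (random_field_measurable rY); exact: (path_sigmaS (@KD n)).
(* The intersection of the [U m] is the event that [Y] falls in infinitely many of the [A n]. *)
pose U m := \bigcup_(n in [set n | (m <= n)%N]) (Y @^-1` A n).
have mU m : measurable (U m) by apply: bigcup_measurable => k _.
have mI : measurable (\bigcap_m U m) by exact: bigcapT_measurable.
have mB : measurable (Y @^-1` B) by exact: (random_field_measurable rY).
have IB : \bigcap_m U m `<=` Y @^-1` B.
  move=> w Uw.
  (* When [Y w] is not in [A n], the path [Y w] itself serves as a filler; the closure hypothesis on
     [B] only asks for infinitely many good indices. *)
  have /(_ _)/cid-/all_sig[g gP] : forall n, exists g : X -> \bar R,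
      (forall i, K n i -> g i = Y w i) /\ (A n (Y w) -> B g).
    move=> n; have [[g Cg gY]|nA] := pselect (A n (Y w)).
      by exists g; split=> // _; case: (pC n) => _ + _; exact.
    by exists (Y w).
  apply: (clB _ g) => [n i Ki|m]; first by case: (gP n) => + _; exact.
  have [n /= mn An] := Uw m Logic.I.
  by exists n => //; case: (gP n) => _; exact.
have : (P \o U) x @[x --> \oo] --> P (\bigcap_m U m).
  apply: nonincreasing_cvg_mu => //.
    by rewrite (le_lt_trans (probability_le1 _ _)) ?ltry.
  move=> m n mn; apply/subsetPset => w [k /= nk Ak].
  by exists k => //=; exact: leq_trans nk.
move=> cU.
have nearU : \forall n \near \oo, (P (U n) <= P (Y @^-1` B) + (eta / 3)%:E)%E.
  have PI : (P (\bigcap_m U m) < P (Y @^-1` B) + (eta / 3)%:E)%E.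
    rewrite (le_lt_trans (le_measure P _ _ IB)) ?inE//.
    by rewrite lteDl ?fin_num_measure// lte_fin.
  have cUn : \forall n \near \oo, (P (U n) < P (Y @^-1` B) + (eta / 3)%:E)%E.
    exact: (cU _ (open_ereal_lt' PI)).
  by apply: filterS cUn => n /ltW.
have neard : \forall n \near \oo, delta n <= eta / 3.
  move/cvgrPdist_le : delta0 => /(_ _ eta3).
  by apply: filterS => n; rewrite sub0r normrN; apply: le_trans; exact: ler_norm.
near=> n.
have [_ CB PB] := pC n.
apply: (le_trans PB).
have e3 : eta = eta / 3 + eta / 3 + eta / 3 by field.
rewrite [in leRHS]e3.
rewrite EFinD addeA leeD2r//.
apply: (@le_trans _ _ (P' (F n @^-1` A n))).
  apply: le_measure; rewrite ?inE.
  - apply: (random_field_measurable (rF n)).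
    by apply: compact_paving_measurable; case: (pC n).
  - by apply: (random_field_measurable (rF n)); exact: (path_sigmaS (@KD n)).
  - by apply: preimage_subset => f Cf; exists f.
apply: (le_trans (domK n _ (sA n))).
rewrite EFinD addeA leeD//; last by rewrite lee_fin; near: n.
apply: (@le_trans _ _ (P (U n))).
  by apply: le_measure; rewrite ?inE// => w Aw; exists n => /=.
by near: n.
Unshelve. all: by end_near. Qed.

(** * Expectations from tail probabilities *)

Lemma staircase_bounds (R : realFieldType) (k : nat) (x : R) : 0 <= x <= k%:R ->
  \sum_(j < k) (j.+1%:R <= x)%R%:R <= x <= \sum_(j < k) (j.+1%:R <= x)%R%:R + 1.
Proof.
pose S (k : nat) : R := \sum_(j < k) (j.+1%:R <= x)%R%:R.
move=> /andP[x0 xk]; suff : S k <= x <= S k + 1 by [].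
have SS m : S m.+1 = S m + (m.+1%:R <= x)%R%:R by rewrite /S big_ord_recr.
have S0 : S 0%N = 0 by rewrite /S big_ord0.
(* The sum counts the positive integers up to [m] that are at most [x]. The middle clause,
   saturation while [m] is below [x], carries the induction. *)
have H m : [/\ S m <= x, (m%:R <= x -> S m = m%:R) & (x <= m%:R -> x <= S m + 1)].
  elim: m => [|m [h1 h2 h3]]; first by rewrite S0 mulr0n; split=> // ?; lra.
  rewrite SS -natr1; have [mx|xm] := leP (m%:R + 1) x.
  - have Sm : S m = m%:R by apply: h2; lra.
    by rewrite Sm mulr1n; split=> [|_|?]; lra.
  - rewrite mulr0n addr0; split=> [|?|_]; [lra|lra|].
    by have [/h2|/ltW/h3] := leP m%:R x; lra.
by have [h1 h2 h3] := H k; rewrite h1 h3.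
Qed.

Section layers.
Context {R : realType} {d : measure_display} {T : measurableType d}.
Variable P : probability T R.

Lemma integral_staircase (k : nat) (g : T -> R) : measurable_fun setT g ->
  (forall w, 0 <= g w <= k%:R) ->
  (\sum_(j < k) P [set w | j.+1%:R <= g w]%R <= \int[P]_w (g w)%:E
   <= \sum_(j < k) P [set w | j.+1%:R <= g w]%R + 1)%E.
Proof.
move=> mg g01.
have mA (a : R) : measurable [set w | a <= g w].
  by rewrite -[X in measurable X]setTI; exact: measurable_fun_le.
have mS : measurable_fun setT (fun w => \sum_(j < k) ((j.+1%:R <= g w)%R%:R : R)).
  apply: measurable_sum => j.
  have -> : (fun w => ((j.+1%:R <= g w)%R%:R : R)) = \1_[set w | j.+1%:R <= g w].
    by apply/funext => w; rewrite indicE mem_setE.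
  exact: measurable_indic.
have IS : (\int[P]_w (\sum_(j < k) ((j.+1%:R <= g w)%R%:R : R))%:E =
    \sum_(j < k) P [set w | j.+1%:R <= g w]%R)%E.
  under eq_integral do rewrite -sumEFin.
  rewrite ge0_integral_sum//; last first.
    move=> j; apply/measurable_EFinP.
    have -> : (fun w => ((j.+1%:R <= g w)%R%:R : R)) = \1_[set w | j.+1%:R <= g w].
      by apply/funext => w; rewrite indicE mem_setE.
    exact: measurable_indic.
  apply: eq_bigr => j _; rewrite -[X in _ = P X]setIT -integral_indic//.
  by apply: eq_integral => w _; rewrite indicE mem_setE.
apply/andP; split.
  rewrite -IS; apply: ge0_le_integral => //.
  - by move=> w _; rewrite lee_fin sumr_ge0.
  - exact/measurable_EFinP.
  - exact/measurable_EFinP.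
  - by move=> w _; rewrite lee_fin; case/andP: (staircase_bounds (g01 w)).
have -> : (1 = \int[P]_w (1%:E : \bar R))%E.
  by rewrite integral_cst// mul1e; exact/esym/probability_setT.
rewrite -IS -ge0_integralD//=; last 2 first.
  by move=> w _; rewrite lee_fin sumr_ge0.
  exact/measurable_EFinP.
apply: ge0_le_integral => //.
- by move=> w _; rewrite lee_fin; case/andP: (g01 w).
- exact/measurable_EFinP.
- by apply: emeasurable_funD => //; exact/measurable_EFinP.
- by move=> w _; rewrite -EFinD lee_fin; case/andP: (staircase_bounds (g01 w)).
Qed.

Lemma bounded_Lfun1 (M : R) (f : T -> R) : measurable_fun setT f ->
  (forall w, `|f w| <= M) -> f \in Lfun P 1.
Proof.
move=> mf fM; apply/Lfun1_integrable; apply: measurable_bounded_integrable => //.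
  by rewrite (le_lt_trans (probability_le1 P measurableT)) ?ltry.
exists M; split; first exact: num_real.
by move=> x /ltW Mx w _; exact: le_trans Mx.
Qed.

(** Shifting by [M] and dividing by the mesh [h] gives a nonnegative function to which the unit
    staircase applies. *)
Lemma expectation_affine (M h : R) (f : T -> R) : 0 < h ->
  measurable_fun setT f -> (forall w, `|f w| <= M) ->
  'E_P[f]%E = (h%:E * (\int[P]_w ((f w + M) / h)%:E) - M%:E)%E.
Proof.
move=> h0 mf fM; pose g w := (f w + M) / h.
have fg : f = ((h \o* g) \- cst M)%R.
  by apply/funext => w; rewrite /= /g divfK ?gt_eqF// addrK.
have mg : measurable_fun setT g by apply: measurable_funM => //; exact: measurable_funD.
have g1 : g \in Lfun P 1.
  apply: (@bounded_Lfun1 ((M + `|M|) / h)) => // w.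
  have hi : 0 < h^-1 by rewrite invr_gt0.
  rewrite /g normrM (gtr0_norm hi) ler_pM2r// (le_trans (ler_normD _ _))// lerD2r; exact: fM.
rewrite [in LHS]fg expectationB//; last first.
- exact: Lfun_cst.
- exact: Lfun_scale.
by rewrite expectationZl// expectation_cst [in LHS]unlock.
Qed.
End layers.

(** A layer-cake sum with mesh [h] involves only finitely many levels, so the tail bounds eventually
    hold at all of them at once. *)
Lemma limsup_expectation (R : realType) (d d' : measure_display)
    (T : measurableType d) (T' : measurableType d')
    (P : probability T R) (P' : probability T' R) (M : R)
    (f : nat -> T' -> R) (g : T -> R) :
  (forall n, measurable_fun setT (f n)) -> measurable_fun setT g ->
  (forall n w, `|f n w| <= M) -> (forall w, `|g w| <= M) ->
  (forall a eta : R, 0 < eta -> \forall n \near \oo,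
    (P' [set w | a <= f n w]%R <= P [set w | a <= g w]%R + eta%:E)%E) ->
  forall eta : R, 0 < eta ->
  \forall n \near \oo, ('E_P'[f n] <= 'E_P[g] + eta%:E)%E.
Proof.
move=> mf mg fM gM tails eta eta0.
pose N : R := `|M| + 1.
have N0 : 0 < N by rewrite ltr_wpDl.
have MN : M <= N by rewrite /N (le_trans (ler_norm _))// lerDl.
(* The final error is 2 h: one unit step for the staircase, and one for the [k] tail errors of size
   1/k. With h = 2 N / k this is at most eta once k exceeds 4 N / eta. *)
pose k := (Num.truncn (4 * N / eta)).+1.
have k0 : 0 < k%:R :> R by rewrite ltr0n.
pose h := 2 * N / k%:R.
have h0 : 0 < h by rewrite divr_gt0// mulr_gt0.
have h2 : 2 * h <= eta.
  have : 4 * N / eta < k%:R by exact: truncnS_gt.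
  rewrite /h ltr_pdivrMr// mulrA ler_pdivrMr// => /ltW.
  by rewrite [k%:R * _]mulrC; lra.
have hk : h * k%:R = 2 * N by rewrite /h divfK ?gt_eqF.
have range01 (x : R) : `|x| <= M -> 0 <= (x + N) / h <= k%:R.
  rewrite ler_norml => /andP[Mx xM].
  rewrite divr_ge0 ?(ltW h0)//=; last by lra.
  by rewrite ler_pdivrMr// mulrC hk; lra.
have level (j : nat) (x : R) : (j.+1%:R <= (x + N) / h) = (j.+1%:R * h - N <= x).
  by rewrite ler_pdivlMr// lerBlDr.
have fN n w : `|f n w| <= N by exact: le_trans (fM n w) MN.
have gN w : `|g w| <= N by exact: le_trans (gM w) MN.
have mscale (d0 : measure_display) (T0 : measurableType d0) (u : T0 -> R) :
    measurable_fun setT u -> measurable_fun setT (fun w => (u w + N) / h).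
  by move=> mu; apply: measurable_funM => //; exact: measurable_funD.
have near_tails : \forall n \near \oo, forall j : 'I_k,
    (P' [set w | j.+1%:R * h - N <= f n w]%R <=
     P [set w | j.+1%:R * h - N <= g w]%R + (k%:R^-1)%:E)%E.
  by apply: filter_forall => j; apply: tails; rewrite invr_gt0.
apply: filterS near_tails => n tn.
rewrite (expectation_affine P' h0 (mf n) (fN n)) (expectation_affine P h0 mg gN).
have /andP[_ up] := integral_staircase P' (mscale _ _ _ (mf n))
  (fun w => range01 _ (fM n w)).
have /andP[lo _] := integral_staircase P (mscale _ _ _ mg)
  (fun w => range01 _ (gM w)).
have key : (\int[P']_w ((f n w + N) / h)%:E <=
    \int[P]_w ((g w + N) / h)%:E + 2%:E)%E.
  apply: (le_trans up).
  rewrite (_ : 2%:E = 1%:E + 1%:E)%E; last by rewrite -EFinD.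
  rewrite addeA leeD2r//; apply: le_trans (leeD2r _ lo).
  have -> : (1%:E : \bar R) = (\sum_(j < k) (k%:R^-1)%:E)%E.
    rewrite sumEFin sumr_const card_ord -[_ *+ k]mulr_natl divff//.
    by rewrite gt_eqF.
  rewrite -big_split /=; apply: lee_sum => j _.
  have e (d0 : measure_display) (T0 : measurableType d0) (u : T0 -> R) :
      [set w | j.+1%:R <= (u w + N) / h] = [set w | j.+1%:R * h - N <= u w].
    by apply/funext => w /=; rewrite level.
  by rewrite !e; exact: tn.
rewrite addeAC leeD2r//.
apply: (@le_trans _ _ (h%:E * (\int[P]_w ((g w + N) / h)%:E + 2%:E))%E).
  by apply: lee_wpmul2l => //; rewrite lee_fin ltW.
rewrite muleDr//; last first.
  by rewrite fin_num_adde_defl.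
by rewrite leeD2l// -EFinM lee_fin mulrC.
Qed.

(** * The fixed point from the increments of the landscape *)

Lemma ae_eq_probability (R : realType) (d : measure_display)
    (T : measurableType d) (P : probability T R) (A B : set T) :
  measurable A -> measurable B -> {ae P, forall w, A w <-> B w} -> P A = P B.
Proof.
move=> mA mB [N [mN PN sub]].
have key (C E : set T) : measurable C -> measurable E ->
    C `<=` E `|` N -> (P C <= P E)%E.
  move=> mC mE CEN; rewrite -[leRHS]adde0 -PN.
  apply: le_trans (measureU2 _ mE mN).
  by apply: le_measure; rewrite ?inE//; exact: measurableU.
apply/eqP; rewrite eq_le; apply/andP; split; apply: key => // w h.
- have [Bw|nB] := pselect (B w); [by left|right].
  by apply: sub => /= AB; apply: nB; exact/AB.
- have [Aw|nA] := pselect (A w); [by left|right].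
  by apply: sub => /= AB; apply: nA; exact/AB.
Qed.

(** Turns suprema over space into countable ones, hence measurable. Integers coding no rational give
    the harmless value 0. *)
Definition rat_enum (R : realType) (n : nat) : R :=
  ratr (odflt 0 (unpickle n : option rat)).

Lemma rat_enumP (R : realType) (q : rat) : exists n, rat_enum R n = ratr q.
Proof. by exists (pickle q); rewrite /rat_enum pickleK. Qed.

Lemma ereal_sup_rat (R : realType) (phi : R -> R) : continuous phi ->
  ereal_sup [set (phi z)%:E | z in [set: R]] =
  ereal_sup [set (phi (rat_enum R n))%:E | n in [set: nat]].
Proof.
move=> cphi; apply/eqP; rewrite eq_le; apply/andP; split; last first.
  by apply: le_ereal_sup => _ [n _ <-]; exists (rat_enum R n).
apply: ge_ereal_sup => _ [z _ <-]; rewrite leNgt; apply/negP => Sz.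
have : \forall u \near z, (ereal_sup
    [set (phi (rat_enum R n))%:E | n in [set: nat]] < (phi u)%:E)%E.
  have cE : (phi u)%:E @[u --> z] --> (phi z)%:E.
    by apply: cvg_EFin; [near=> u|exact: cphi].
  exact: (cE _ (open_ereal_gt' Sz)).
move=> /nbhs_ballP[e /= e0 ze].
have [q] : exists q : rat, ratr q \in `]z - e, z + e[.
  by apply: rat_in_itvoo; rewrite ltrBlDr -addrA ltrDl addr_gt0.
have [n <-] := rat_enumP R q; rewrite in_itv /= => /andP[q1 q2].
have /ze : ball z e (rat_enum R n).
  by rewrite /ball /= ltr_distlC; apply/andP; split.
by apply/negP; rewrite -leNgt; apply: ereal_sup_ubound; exists n.
Unshelve. all: by end_near. Qed.

Lemma open_R4up (R : realType) : open (@R4up R).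
Proof.
have -> : @R4up R = (fun p : R * R * R * R => p.2 - p.1.1.2) @^-1` [set x | 0 < x].
  by apply/seteqP; split=> p; rewrite /R4up /= subr_gt0.
apply: open_comp; last exact: open_gt.
move=> p _; apply: (@cvgB _ R^o); first exact: cvg_snd.
apply: (@continuous_comp _ _ _ (fun p : R * R * R * R => p.1.1) snd).
  apply: (@continuous_comp _ _ _ (fun p : R * R * R * R => p.1) fst); exact: cvg_fst.
exact: cvg_snd.
Qed.

Lemma continuous_R4up (R : realType) (f : R * R * R * R -> R) (s t : R) :
  s < t -> {within @R4up R, continuous f} ->
  forall x y, {for (x, y), continuous (fun p : R * R => f (p.1, s, p.2, t))}.
Proof.
move=> st; rewrite continuous_open_subspace; last exact: open_R4up.
move=> cf x y.
apply: (@continuous_comp _ _ _ (fun p : R * R => (p.1, s, p.2, t)) f); last first.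
  by apply: (cf (x, s, y, t)); rewrite inE.
have c1 : (p.1, s) @[p --> (x, y)] --> (x, s).
  by apply: (@cvg_pair _ _ _ _ (nbhs x) (nbhs s)); [exact: cvg_fst|exact: cvg_cst].
have c2 : (p.1, s, p.2) @[p --> (x, y)] --> (x, s, y).
  by apply: (@cvg_pair _ _ _ _ (nbhs (x, s)) (nbhs y)) => //; exact: cvg_snd.
by apply: (@cvg_pair _ _ _ _ (nbhs (x, s, y)) (nbhs t)) => //; exact: cvg_cst.
Qed.

Lemma narrow_wedge_fixed_point (R : realType) (L : R * R * R * R -> R) (y t : R) :
  kpz_fixed_point (@narrow_wedge R) L y t =
  if 0 < t then (L (0, 0, y, t))%:E else narrow_wedge y.
Proof.
rewrite /kpz_fixed_point /fixed_point_on; case: ifP => // t0.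
apply/eqP; rewrite eq_le; apply/andP; split.
  apply: ge_ereal_sup => _ [x _ <-]; rewrite /narrow_wedge.
  by case: eqP => [->|_]; rewrite ?add0e// addNye leNye.
apply: ereal_sup_ubound; exists 0 => //.
by rewrite /narrow_wedge eqxx add0e.
Qed.

(** The wedge is finite only at integers, and 0 is the only integer in the fundamental domain
    [torus]. *)
Lemma periodic_narrow_wedge_fixed_point (R : realType)
    (L : R * R * R * R -> R) (y t : R) :
  periodic_kpz_fixed_point (@periodic_narrow_wedge R) L y t =
  if 0 < t then (L (0, 0, y, t))%:E else periodic_narrow_wedge y.
Proof.
rewrite /periodic_kpz_fixed_point /fixed_point_on; case: ifP => // t0.
apply/eqP; rewrite eq_le; apply/andP; split.
  apply: ge_ereal_sup => _ [x + <-]; rewrite /torus /= in_itv /= => /andP[x0 x1].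
  rewrite /periodic_narrow_wedge; case: ifPn; last by rewrite addNye leNye.
  move=> /intrP[m mx]; suff -> : x = 0 by rewrite add0e.
  move: x0 x1; rewrite mx ler0z ltrz1 => m0 m1.
  have -> : m = 0; last by [].
  by apply: le_anti; rewrite m0 -ltzD1 add0r m1.
apply: ereal_sup_ubound; exists 0; first by rewrite /torus /= in_itv /= lexx ltr01.
by rewrite /periodic_narrow_wedge rpred0 add0e.
Qed.

(** Here [j (k, (z, y))] stands for the landscape increment from z to y over the k-th time interval.
    Restricting the intermediate point to rationals makes the result a measurable function of the
    increments. *)
Fixpoint composed_increments (R : realType) (j : nat * (R * R) -> R) (k : nat)
    (y : R) : \bar R :=
  if k is k'.+1 then
    ereal_sup [set (composed_increments j k' (rat_enum R n) +
                    (j (k', (rat_enum R n, y)))%:E)%E | n in [set: nat]]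
  else narrow_wedge y.

Lemma composed_increments_measurable (R : realType) (n k : nat) (y : R)
    (B : set (\bar R)) : (k <= n)%N -> measurable B ->
  path_sigma [set q : nat * (R * R) | (q.1 < n)%N /\ [set: R * R] q.2]
    [set j : nat * (R * R) -> R | B (composed_increments j k y)].
Proof.
move=> kn mB.
set D := [set q : nat * (R * R) | _].
pose T0 := g_sigma_algebraType (@cylinder (nat * (R * R)) _ R D).
suff mu : measurable_fun [set: T0]
    ((fun j : nat * (R * R) -> R => composed_increments j k y) : T0 -> \bar R).
  by have := mu measurableT _ mB; rewrite setTI.
elim: k y kn => [|k IH] y kn; first exact: measurable_cst.
pose f (m : nat) (j : T0) := (composed_increments j k (rat_enum R m) +
  ((j : nat * (R * R) -> R) (k, (rat_enum R m, y)))%:E)%E.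
have -> : (fun j : nat * (R * R) -> R => composed_increments j k.+1 y) =
    (fun j => esups (f ^~ j) 0%N).
  apply/funext => j; rewrite /esups /sdrop /=; congr ereal_sup.
  by apply/seteqP; split=> _ [m _ <-]; exists m.
apply: measurable_fun_esups => m.
apply: emeasurable_funD; first by apply: IH; exact: ltnW.
apply/measurable_EFinP => _ C mC; rewrite setTI.
by apply: (@path_sigma_cylinder _ _ _ D (k, (rat_enum R m, y))).
Qed.

Lemma composed_incrementsE (R : realType) (L : R * R * R * R -> R)
    (n : nat) (tau : nat -> R) :
  {within @R4up R, continuous L} ->
  (forall s r t x y : R, s < r -> r < t -> (L (x, s, y, t))%:E =
    ereal_sup [set (L (x, s, z, r) + L (z, r, y, t))%:E | z in [set: R]]) ->
  tau 0%N = 0 -> (forall k, (k < n)%N -> tau k < tau k.+1) ->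
  forall k y, (k <= n)%N ->
  composed_increments
    (fun q : nat * (R * R) => L (q.2.1, tau q.1, q.2.2, tau q.1.+1)) k y =
  kpz_fixed_point (@narrow_wedge R) L y (tau k).
Proof.
move=> cL compL tau0 tauS.
have tau_ge0 k : (k <= n)%N -> 0 <= tau k.
  elim: k => [|k IH] kn; first by rewrite tau0.
  by rewrite (le_trans (IH (ltnW kn)))// ltW// tauS.
elim=> [|k IH] y kn.
  by rewrite narrow_wedge_fixed_point tau0 ltxx.
have tk : tau k < tau k.+1 by exact: tauS.
rewrite narrow_wedge_fixed_point (le_lt_trans (tau_ge0 _ (ltnW kn)) tk) /=.
have -> : [set (composed_increments
    (fun q : nat * (R * R) => L (q.2.1, tau q.1, q.2.2, tau q.1.+1)) k
    (rat_enum R m) + (L (rat_enum R m, tau k, y, tau k.+1))%:E)%E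
    | m in [set: nat]] =
  [set (kpz_fixed_point (@narrow_wedge R) L (rat_enum R m) (tau k) +
    (L (rat_enum R m, tau k, y, tau k.+1))%:E)%E | m in [set: nat]].
  by apply/seteqP; split=> _ [m _ <-]; exists m => //; rewrite IH// ltnW.
(* At [tau k] = 0 there is no increment before the intermediate time to compose with; the wedge then
   selects the rational 0. At positive times, metric composition applies and continuity reduces its
   supremum to rationals. *)
have := tau_ge0 _ (ltnW kn); rewrite le_eqVlt => /predU1P[t0|t0].
  rewrite -t0; rewrite -t0 in tk.
  apply/eqP; rewrite eq_le; apply/andP; split.
    apply: ge_ereal_sup => _ [m _ <-].
    rewrite narrow_wedge_fixed_point ltxx /narrow_wedge.
    by case: eqP => [->|_]; rewrite ?add0e// addNye leNye.
  have [m m0] := rat_enumP R 0; rewrite rmorph0 in m0.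
  apply: ereal_sup_ubound; exists m => //.
  by rewrite narrow_wedge_fixed_point ltxx /narrow_wedge m0 eqxx add0e.
rewrite (compL 0 (tau k))// (@ereal_sup_rat _ (fun z =>
  L (0, 0, z, tau k) + L (z, tau k, y, tau k.+1))).
  congr ereal_sup; apply/seteqP; split=> _ [m _ <-]; exists m => //;
  by rewrite narrow_wedge_fixed_point t0 EFinD.
move=> z; apply: (@cvgD _ R^o).
- apply: (@continuous_comp _ _ _ (fun z : R => (0 : R, z))
    (fun p : R * R => L (p.1, 0, p.2, tau k))).
    by apply: (@cvg_pair _ _ _ _ (nbhs (0 : R)) (nbhs z)); [exact: cvg_cst|exact: cvg_id].
  exact: continuous_R4up.
- apply: (@continuous_comp _ _ _ (fun z : R => (z, y))
    (fun p : R * R => L (p.1, tau k, p.2, tau k.+1))).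
    by apply: (@cvg_pair _ _ _ _ (nbhs z) (nbhs y)); [exact: cvg_id|exact: cvg_cst].
  exact: continuous_R4up.
Qed.

Section narrow_wedge_law.
Context {R : realType} {d : measure_display} {T : measurableType d}.
Variables (P : probability T R) (L : T -> R * R * R * R -> R).
Hypothesis rcL : random_continuous (@R4up R) L.

Lemma narrow_wedge_random_field : random_field (@upper_half R)
  (fun w p => kpz_fixed_point (@narrow_wedge R) (L w) p.1 p.2).
Proof.
move=> [y t] /= _.
apply: (@eq_measurable_fun _ _ _ _ _ (fun w =>
  if 0 < t then (L w (0, 0, y, t))%:E else narrow_wedge y)).
  by move=> w _; rewrite /= narrow_wedge_fixed_point.
have [t0|_] := ltP 0 t; last exact: measurable_cst.
by apply/measurable_EFinP; exact: rcL.1.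
Qed.

Lemma increment_random_field (s t : R) : s < t ->
  random_field [set: R * R] (increment L s t).
Proof. by move=> st [x y] _; exact: rcL.1. Qed.

Lemma independent_successive_increments (n : nat) (tau : nat -> R) :
  independent_increments [set: R] P L ->
  (forall k, (k < n)%N -> tau k < tau k.+1) ->
  independent_fields [set: R * R] P
    (fun k : 'I_n => increment L (tau k) (tau k.+1)).
Proof.
move=> iL tauS; apply: iL; first by move=> k; split=> //; exact: tauS.
have mono k l : (k <= l <= n)%N -> tau k <= tau l.
  elim: l => [|l IH]; first by rewrite leqn0 => /andP[/eqP -> _].
  move=> /andP[]; rewrite leq_eqVlt => /predU1P[-> //|]; rewrite ltnS => kl ln.
  by rewrite (le_trans (IH _))// ?kl ?(ltnW ln)// ltW// tauS.
have disj (k l : 'I_n) : (k < l)%N ->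
    `]tau k, tau k.+1[ `&` `]tau l, tau l.+1[ = set0 :> set R.
  move=> kl; apply/seteqP; split=> // x [] /=; rewrite !in_itv /=.
  move=> /andP[_ x1] /andP[x2 _].
  have := lt_trans x2 x1; rewrite ltNge mono//.
  by rewrite kl ltnW.
move=> k l; rewrite neq_ltn => /orP[kl|lk]; first exact: disj.
by rewrite setIC; exact: disj.
Qed.

End narrow_wedge_law.

(** * Scale invariance *)

(** Cuts the time axis for an event depending on finitely many times: the positive times of [s] are
    sorted without repetition behind a leading 0, and [kappa] is the position in that list. *)
Lemma increasing_enumeration (R : realDomainType) (s : seq R) :
  exists (n : nat) (tau : nat -> R) (kappa : R -> nat),
  [/\ tau 0%N = 0, forall k, (k < n)%N -> tau k < tau k.+1 &
      forall t, t \in s -> 0 <= t -> (kappa t <= n)%N /\ tau (kappa t) = t].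
Proof.
pose r := sort <=%R (undup [seq t <- s | 0 < t]).
pose u := 0 :: r.
have su : sorted <%R u.
  rewrite /u /= lt_path_sortedE sort_lt_sorted undup_uniq andbT.
  by apply/allP => t; rewrite mem_sort mem_undup mem_filter => /andP[].
exists (size r), (nth 0 u), (index^~ u); split=> //.
  move=> k kr; apply: (sorted_ltn_nth lt_trans 0 su); rewrite ?inE //=.
  exact: leqW.
move=> t ts t0; have tu : t \in u.
  rewrite inE mem_sort mem_undup mem_filter ts andbT.
  by move: t0; rewrite le_eqVlt eq_sym.
by rewrite nth_index//; split=> //; rewrite -ltnS -[(size r).+1]/(size u) index_mem.
Qed.

(** Events depending on finitely many times form a generating pi-system. At such times the fixed
    point is almost surely a measurable function of independent successive increments, whose joint
    law is determined by the individual ones. *)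
Lemma eq_law_narrow_wedge (R : realType) (d1 d2 : measure_display)
    (T1 : measurableType d1) (T2 : measurableType d2)
    (P1 : probability T1 R) (P2 : probability T2 R)
    (L1 : T1 -> R * R * R * R -> R) (L2 : T2 -> R * R * R * R -> R) :
  random_continuous (@R4up R) L1 -> random_continuous (@R4up R) L2 ->
  independent_increments [set: R] P1 L1 ->
  independent_increments [set: R] P2 L2 ->
  metric_composition [set: R] [set: R] P1 L1 ->
  metric_composition [set: R] [set: R] P2 L2 ->
  (forall s t : R, s < t ->
    eq_law [set: R * R] P1 (increment L1 s t) P2 (increment L2 s t)) ->
  eq_law (@upper_half R)
    P1 (fun w p => kpz_fixed_point (@narrow_wedge R) (L1 w) p.1 p.2)
    P2 (fun w p => kpz_fixed_point (@narrow_wedge R) (L2 w) p.1 p.2).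
Proof.
move=> c1 c2 i1 i2 m1 m2 e12 A.
pose slice (s : seq R) := [set p : R * R | 0 <= p.2 /\ p.2 \in s].
pose G := [set A | exists s, @path_sigma _ _ (\bar R) (slice s) A].
have sliceS s : slice s `<=` @upper_half R by move=> p [].
suff : path_sigma (@upper_half R) `<=` <<s G>>.
  move=> /[apply]; apply: probability_pi_lambda.
  - move=> B C [s sB] [s' sC]; exists (s ++ s').
    apply: (@measurableI _ (g_sigma_algebraType (cylinder (slice (s ++ s'))))).
    + apply: path_sigmaS sB => p [p0 ps]; split=> //.
      by rewrite mem_cat ps.
    + apply: path_sigmaS sC => p [p0 ps]; split=> //.
      by rewrite mem_cat ps orbT.
  - move=> B [s sB]; apply: (random_field_measurable (narrow_wedge_random_field c1)).
    exact: path_sigmaS sB.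
  - move=> B [s sB]; apply: (random_field_measurable (narrow_wedge_random_field c2)).
    exact: path_sigmaS sB.
  move=> B [s sB].
  have [n [tau [kappa [tau0 tauS kappaP]]]] := increasing_enumeration s.
  pose Phi (j : nat * (R * R) -> R) (p : R * R) :=
    composed_increments j (kappa p.2) p.1.
  pose D := [set q : nat * (R * R) | (q.1 < n)%N /\ [set: R * R] q.2].
  pose joint (d : measure_display) (T : measurableType d)
    (L : T -> R * R * R * R -> R) (w : T) (q : nat * (R * R)) :=
    increment L (tau q.1) (tau q.1.+1) w q.2.
  have mPhi p C : slice s p -> measurable C -> path_sigma D [set j | C (Phi j p)].
    move=> [p0 ps] mC; apply: composed_increments_measurable => //.
    by case: (kappaP _ ps p0).
  have sPhi := path_sigma_comp mPhi sB.
  have eJ : P1 ((Phi \o joint _ _ L1) @^-1` B) = P2 ((Phi \o joint _ _ L2) @^-1` B).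
    have eq12 := @eq_law_joint R (R * R)%type _ _ _ T1 T2 _ [set: R * R] P1 P2 n
      (fun k => increment L1 (tau k) (tau k.+1))
      (fun k => increment L2 (tau k) (tau k.+1)).
    apply: eq12 sPhi.
    + by move=> k kn; exact: (increment_random_field c1 (tauS _ kn)).
    + by move=> k kn; exact: (increment_random_field c2 (tauS _ kn)).
    + exact: independent_successive_increments.
    + exact: independent_successive_increments.
    + by move=> k kn; apply: e12; exact: tauS.
  have eP (d : measure_display) (T : measurableType d) (P : probability T R)
      (L : T -> R * R * R * R -> R) : random_continuous (@R4up R) L ->
      metric_composition [set: R] [set: R] P L ->
      P ((fun w p => kpz_fixed_point (@narrow_wedge R) (L w) p.1 p.2) @^-1` B) =
      P ((Phi \o joint _ _ L) @^-1` B).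
    (* Metric composition holds only almost surely, so the two forms of the event agree only up to a
       null set. *)
    move=> cL mL; apply: ae_eq_probability.
    - apply: (random_field_measurable (narrow_wedge_random_field cL)).
      exact: path_sigmaS sB.
    - have rJ : random_field D (joint _ _ L).
        move=> [k p] [/= kn _].
        by apply: (increment_random_field cL (tauS _ kn)).
      exact: (random_field_measurable rJ sPhi).
    - apply: filterS mL => w compL.
      apply: path_sigma_saturated sB _ => -[y t] [/= t0 ts].
      have [kn kt] := kappaP _ ts t0.
      rewrite /Phi /= /joint /increment (composed_incrementsE _ _ tau0 tauS _ kn).
      + by rewrite kt.
      + exact: cL.2.
      + by move=> s' r t' x z sr rt; exact: compL.
  by rewrite !eP.
apply: sub_sigma_algebra2 => _ [p [B [p0 mB ->]]].
exists [:: p.2]; apply: path_sigma_cylinder => //.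
by split=> //; rewrite inE.
Qed.

(** The 1:2:3 scaling, parametrised by the cube root [c] of the time factor so that all exponents
    are integers. *)
Definition rescaled (R : realType) (c : R) (T : Type)
    (L : T -> R * R * R * R -> R) (w : T) (p : R * R * R * R) : R :=
  c^-1 * L w (p.1.1.1 * c ^+ 2, p.1.1.2 * c ^+ 3, p.1.2 * c ^+ 2, p.2 * c ^+ 3).

(** * Invariance of the directed landscape under 1:2:3 scaling *)

Section rescaling.
Context {R : realType} {d : measure_display} {T : measurableType d}.
Variables (P : probability T R) (L : T -> R * R * R * R -> R) (c : R).
Hypothesis c0 : 0 < c.
Hypothesis HL : is_directed_landscape P L.

Let rescale_path (f : R * R -> R) (p : R * R) : R :=
  c^-1 * f (p.1 * c ^+ 2, p.2 * c ^+ 2).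

Let measurable_rescale_path (p : R * R) (B : set R) : [set: R * R] p ->
  measurable B -> path_sigma [set: R * R] [set f | B (rescale_path f p)].
Proof.
move=> _ mB.
have mc : measurable ((fun x : R => c^-1 * x) @^-1` B).
  rewrite -[X in measurable X]setTI.
  have mf : measurable_fun [set: R] (fun x : R => c^-1 * x).
    exact: measurable_funM.
  exact: mf.
exact: (@path_sigma_cylinder _ _ _ _ (p.1 * c ^+ 2, p.2 * c ^+ 2) _ Logic.I mc).
Qed.

Let rescaled_increment (s t : R) : increment (rescaled c L) s t =
  rescale_path \o increment L (s * c ^+ 3) (t * c ^+ 3).
Proof. by []. Qed.

Lemma rescaled_random_continuous : random_continuous (@R4up R) (rescaled c L).
Proof.
have [[rL cL] _ _ _] := HL.
have up p : R4up p ->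
    R4up (p.1.1.1 * c ^+ 2, p.1.1.2 * c ^+ 3, p.1.2 * c ^+ 2, p.2 * c ^+ 3).
  by rewrite /R4up /= ltr_pM2r// exprn_gt0.
split=> [p pup|w].
  by apply: measurable_funM => //; exact: (rL _ (up _ pup)).
have := cL w.
rewrite !continuous_open_subspace; try exact: open_R4up.
move=> {}cL; move=> [[[x s] y] t]; rewrite inE => /up pup.
apply: (@cvgM R^o); first exact: cvg_cst.
apply: (@continuous_comp _ _ _ (fun p : R * R * R * R =>
  (p.1.1.1 * c ^+ 2, p.1.1.2 * c ^+ 3, p.1.2 * c ^+ 2, p.2 * c ^+ 3)) (L w));
  last by apply: (cL (_, _, _, _)); rewrite inE.
have c1 : (p.1.1.1 * c ^+ 2) @[p --> (x, s, y, t)] --> x * c ^+ 2.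
  apply: (@cvgMl R); apply: (@cvg_comp _ _ _ (fun p : R * R * R * R => p.1.1) fst).
    by apply: (@cvg_comp _ _ _ fst fst); exact: cvg_fst.
  exact: cvg_fst.
have c2 : (p.1.1.2 * c ^+ 3) @[p --> (x, s, y, t)] --> s * c ^+ 3.
  apply: (@cvgMl R); apply: (@cvg_comp _ _ _ (fun p : R * R * R * R => p.1.1) snd).
    by apply: (@cvg_comp _ _ _ fst fst); exact: cvg_fst.
  exact: cvg_snd.
have c3 : (p.1.2 * c ^+ 2) @[p --> (x, s, y, t)] --> y * c ^+ 2.
  apply: (@cvgMl R); apply: (@cvg_comp _ _ _ fst snd); first exact: cvg_fst.
  exact: cvg_snd.
have c4 : (p.2 * c ^+ 3) @[p --> (x, s, y, t)] --> t * c ^+ 3.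
  by apply: (@cvgMl R); exact: cvg_snd.
have c12 : (p.1.1.1 * c ^+ 2, p.1.1.2 * c ^+ 3) @[p --> (x, s, y, t)] -->
    (x * c ^+ 2, s * c ^+ 3).
  exact: (@cvg_pair _ _ _ _ (nbhs (x * c ^+ 2)) (nbhs (s * c ^+ 3))).
have c123 : (p.1.1.1 * c ^+ 2, p.1.1.2 * c ^+ 3, p.1.2 * c ^+ 2)
    @[p --> (x, s, y, t)] --> (x * c ^+ 2, s * c ^+ 3, y * c ^+ 2).
  exact: (@cvg_pair _ _ _ _ (nbhs (x * c ^+ 2, s * c ^+ 3)) (nbhs (y * c ^+ 2))).
exact: (@cvg_pair _ _ _ _ (nbhs (x * c ^+ 2, s * c ^+ 3, y * c ^+ 2))
  (nbhs (t * c ^+ 3))).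
Qed.

Lemma rescaled_independent_increments :
  independent_increments [set: R] P (rescaled c L).
Proof.
have [_ iL _ _] := HL => n s t st disj A sA.
have c3 : 0 < c ^+ 3 by rewrite exprn_gt0.
have := iL n (fun k => s k * c ^+ 3) (fun k => t k * c ^+ 3) _ _
  (fun k => rescale_path @^-1` A k).
apply=> [k|k l kl|k].
- by split=> //; case: (st k) => _ _; rewrite ltr_pM2r.
- apply/seteqP; split=> // x []; rewrite /= !in_itv /= => /andP[x1 x2] /andP[x3 x4].
  have := disj k l kl => /seteqP[/(_ (x / c ^+ 3)) + _]; apply.
  by split; rewrite /= in_itv /= ?ltr_pdivlMr ?ltr_pdivrMr// ?x1 ?x2 ?x3 ?x4.
- by apply: path_sigma_comp (sA k); exact: measurable_rescale_path.
Qed.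

Lemma rescaled_metric_composition :
  metric_composition [set: R] [set: R] P (rescaled c L).
Proof.
have [_ _ _ mL] := HL.
have c3 : 0 < c ^+ 3 by rewrite exprn_gt0.
apply: filterS mL => w comp s r t x y _ _ _ sr rt.
rewrite /rescaled /= EFinM (comp _ (r * c ^+ 3)) ?ltr_pM2r//.
rewrite -ereal_sup_pZl ?invr_gt0//; congr ereal_sup.
apply/seteqP; split=> [_ [_ [z _ <-] <-]|_ [z _ <-]].
  exists (z / c ^+ 2) => //=.
  by rewrite divfK ?gt_eqF ?exprn_gt0// -mulrDr EFinM.
exists (L w (x * c ^+ 2, s * c ^+ 3, z * c ^+ 2, r * c ^+ 3) +
  L w (z * c ^+ 2, r * c ^+ 3, y * c ^+ 2, t * c ^+ 3))%:E.
  by exists (z * c ^+ 2).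
by rewrite -mulrDr EFinM.
Qed.

(** With [sigma] the cube root of t - s, the unscaled increment involved is an Airy sheet of scale
    [sigma * c]; rescaling by [c] returns the sheet of scale [sigma]. *)
Lemma eq_law_rescaled_increment (s t : R) : s < t ->
  eq_law [set: R * R] P (increment (rescaled c L) s t) P (increment L s t).
Proof.
move=> st.
have [_ _ [d1 [T1 [P1 [S [_ sheet]]]]] _] := HL.
pose sigma := (t - s) `^ (3%:R^-1).
have sigma0 : 0 < sigma by rewrite powR_gt0 ?subr_gt0.
have sigma3 : sigma ^+ 3 = t - s.
  rewrite -powR_mulrn ?ltW// -powRrM mulVf// powRr1// subr_ge0.
  exact: ltW.
have tE : t = s + sigma ^+ 3 by rewrite sigma3 addrC subrK.
have tcE : t * c ^+ 3 = s * c ^+ 3 + (sigma * c) ^+ 3.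
  by rewrite exprMn -mulrDl -tE.
have h1 := sheet s sigma sigma0.
have h2 := sheet (s * c ^+ 3) (sigma * c) (mulr_gt0 sigma0 c0).
have h3 := eq_law_comp measurable_rescale_path h2.
have e : (rescale_path \o (fun (w : T1) (p : R * R) =>
    sigma * c * S w (p.1 / (sigma * c) ^+ 2, p.2 / (sigma * c) ^+ 2))) =
    (fun w p => sigma * S w (p.1 / sigma ^+ 2, p.2 / sigma ^+ 2)).
  apply/funext => w; apply/funext => p; rewrite /= /rescale_path /=.
  have sc (x : R) : x * c ^+ 2 / (sigma * c) ^+ 2 = x / sigma ^+ 2.
    by field; rewrite ?gt_eqF.
  by rewrite !sc [sigma * c]mulrC !mulrA mulVf ?gt_eqF// mul1r.
rewrite e in h3.
move=> A sA; rewrite rescaled_increment tcE h3// [in RHS]tE.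
by rewrite h1.
Qed.

Lemma eq_law_rescaled_narrow_wedge : eq_law (@upper_half R)
    P (fun w p => kpz_fixed_point (@narrow_wedge R) (rescaled c L w) p.1 p.2)
    P (fun w p => kpz_fixed_point (@narrow_wedge R) (L w) p.1 p.2).
Proof.
have [cL iL _ mL] := HL.
apply: eq_law_narrow_wedge => //.
- exact: rescaled_random_continuous.
- exact: rescaled_independent_increments.
- exact: rescaled_metric_composition.
- exact: eq_law_rescaled_increment.
Qed.

End rescaling.

(** * Comparison with the periodic fixed point *)

(** The last bound says that the unscaled time [p.2 * c ^+ 3] is at most [c], and the middle one
    that the unscaled position stays in an arc of length [r] centred at 0. *)
Definition scaled_box (R : realType) (r c : R) : set (R * R) :=
  [set p | [/\ 0 <= p.2, `|p.1| * c ^+ 2 <= r / 2 & p.2 * c ^+ 2 <= 1]].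

Lemma compact_scaled_box (R : realType) (r : R) (c : nat -> R)
    (A : set (R * R)) : 0 < r -> c n @[n --> \oo] --> (0 : R) ->
  compact A -> A `<=` @upper_half R ->
  \forall n \near \oo, A `<=` scaled_box r (c n).
Proof.
move=> r0 c0 cA Aup.
have bounded_image (pr : R * R -> R) : continuous pr -> exists2 M : R, 0 < M &
    forall p, A p -> `|pr p| <= M.
  move=> cpr.
  have cprA : compact (pr @` A).
    by apply: continuous_compact cA; exact: continuous_subspaceT.
  have [M [_ HM]] := @compact_bounded R R^o _ cprA.
  exists (`|M| + 1); first by rewrite ltr_wpDl.
  move=> p Ap; apply: HM; last by exists p.
  by rewrite (le_lt_trans (ler_norm _))// ltrDl.
have [M1 M10 A1] := bounded_image fst (fun p => cvg_fst).
have [M2 M20 A2] := bounded_image snd (fun p => cvg_snd).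
have c2 : c n ^+ 2 @[n --> \oo] --> (0 : R).
  have -> : (0 : R) = 0 * 0 by rewrite mulr0.
  by under eq_fun do rewrite expr2; exact: (@cvgM R^o _ _ _ c c).
have d0 : 0 < Num.min (r / 2 / M1) M2^-1 by rewrite lt_min !divr_gt0//= invr_gt0.
move/cvgrPdist_le : c2 => /(_ _ d0); apply: filterS => n.
rewrite sub0r normrN ger0_norm ?sqr_ge0// le_min => /andP[h1 h2] p Ap.
split; first exact: Aup Ap.
  apply: le_trans (ler_wpM2r (sqr_ge0 _) (A1 _ Ap)) _.
  by rewrite mulrC -ler_pdivlMr.
apply: le_trans (ler_wpM2r (sqr_ge0 _) (le_trans (ler_norm _) (A2 _ Ap))) _.
by rewrite -[leRHS](mulfV (lt0r_neq0 M20)) ler_pM2l.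
Qed.

(** On a given compact set the paths eventually coincide with [f], so uniform convergence there is
    immediate. *)
Lemma path_space_cvg (R : realType) (K : nat -> set (R * R))
    (f : path_space R) (g : nat -> path_space R) :
  (forall A, compact A -> A `<=` @upper_half R ->
    \forall n \near \oo, A `<=` K n) ->
  (forall n p, K n p -> g n p = f p) -> g n @[n --> \oo] --> f.
Proof.
move=> AK gf; apply/fam_cvgP => A [cA Aup] B /uniform_nbhs[E [entE EB]].
have := AK _ cA Aup; apply: filterS => n An; apply: EB => p Ap.
by rewrite /= (gf n p (An p Ap)); exact: entourage_refl.
Qed.

(** A single map on landscape paths, applied both to [L] and to [Lper], so that a total variation
    bound between landscapes passes to the fixed points. *)
Definition wedge_path (R : realType) (c : R) (l : R * R * R * R -> R)
    (p : R * R) : \bar R :=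
  if 0 < p.2 then (c^-1 * l (0, 0, p.1 * c ^+ 2, p.2 * c ^+ 3))%:E
  else narrow_wedge p.1.

Lemma wedge_path_measurable (R : realType) (r c : R) (p : R * R)
    (B : set (\bar R)) : 0 < r -> 0 < c -> scaled_box r c p -> measurable B ->
  path_sigma (window (- (r / 2)) r 0 c) [set l | B (wedge_path c l p)].
Proof.
case: p => y t r0 c0 [/= t0 yr tc] mB.
pose W := window (- (r / 2)) r 0 c.
rewrite /wedge_path /=; have [tp|_] := ltP 0 t; last first.
  have [BN|BN] := pselect (B (narrow_wedge y)).
    rewrite (_ : [set l | _] = setT); last by apply/seteqP; split=> l.
    exact: (@measurableT _ (g_sigma_algebraType (cylinder W))).
  rewrite (_ : [set l | _] = set0); last by apply/seteqP; split=> l.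
  exact: (@measurable0 _ (g_sigma_algebraType (cylinder W))).
pose B' := [set x : R | B (c^-1 * x)%:E].
have mB' : measurable B'.
  have mf : measurable_fun [set: R] (fun x : R => (c^-1 * x)%:E).
    by apply/measurable_EFinP; exact: measurable_funM.
  by have := mf measurableT _ mB; rewrite setTI.
apply: (@path_sigma_cylinder _ _ _ W (0, 0, y * c ^+ 2, t * c ^+ 3) B' _ mB').
have [y1 y2] : - (r / 2) <= y * c ^+ 2 /\ y * c ^+ 2 <= r / 2.
  apply/andP; rewrite -ler_norml normrM (ger0_norm (sqr_ge0 _)); exact: yr.
have tc3 : t * c ^+ 3 <= c.
  by rewrite exprSr mulrA ler_piMl// ltW.
split; rewrite /= ?in_itv /= ?add0r ?lexx ?(ltW c0) ?tc3 ?mulr_ge0 ?exprn_ge0 ?(ltW c0)//.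
- by apply/andP; split; lra.
- by apply/andP; split; lra.
- by rewrite mulr_gt0// exprn_gt0.
Qed.

Lemma kpz_rescaledE (R : realType) (T : Type) (L : T -> R * R * R * R -> R)
    (c : R) (w : T) (p : R * R) :
  kpz_fixed_point (@narrow_wedge R) (rescaled c L w) p.1 p.2 =
  wedge_path c (L w) p.
Proof.
by rewrite narrow_wedge_fixed_point /wedge_path /rescaled /= !mul0r.
Qed.

Lemma periodic_kpz_rescaledE (R : realType) (l : R * R * R * R -> R) (r e : R)
    (p : R * R) : r < 1 -> 0 < e -> scaled_box r (e `^ (1 / 3)) p ->
  ((e `^ (- (1 / 3)))%R%:E *
    periodic_kpz_fixed_point (@periodic_narrow_wedge R) l
      (p.1 * e `^ (2 / 3))%R (p.2 * e)%R)%E = wedge_path (e `^ (1 / 3)) l p.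
Proof.
move=> r1 e0 [p20 p1r _].
set c := e `^ (1 / 3).
have c0 : 0 < c by rewrite powR_gt0.
have c2 : e `^ (2 / 3) = c ^+ 2.
  by rewrite -powR_mulrn ?ltW// -powRrM; congr (_ `^ _); field.
have c3 : e = c ^+ 3.
  rewrite -powR_mulrn ?ltW// -powRrM (_ : 1 / 3 * 3%:R = 1 :> R); last by field.
  by rewrite powRr1 ?ltW.
rewrite periodic_narrow_wedge_fixed_point /wedge_path pmulr_lgt0//.
rewrite powRN -/c c2 {1}c3.
case: ifP => t0; first by rewrite -EFinM.
rewrite /periodic_narrow_wedge /narrow_wedge.
have [->|y0] := eqVneq p.1 0; first by rewrite mul0r rpred0 mule0.
case: ifPn => [yint|_]; last by rewrite gt0_muleNy// lte_fin invr_gt0.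
have yc0 : p.1 * c ^+ 2 != 0 by rewrite mulf_neq0// expf_neq0// lt0r_neq0.
(* At time 0 the periodic wedge also vanishes at nonzero integers, but inside the box the unscaled
   position is at most r / 2 < 1 in absolute value. *)
have := norm_intr_ge1 yint yc0.
rewrite normrM [`|c ^+ 2|]ger0_norm ?sqr_ge0// => h.
have hr : 1 <= r / 2 by exact: le_trans h p1r.
by exfalso; lra.
Qed.

Lemma continuous_oppr_comp (R : realType) (S : topologicalType) (G : S -> R) :
  continuous G -> continuous (fun f => - G f).
Proof. by move=> cG f; apply: (@cvgN _ R^o); exact: cG. Qed.

(** * Convergence of expectations of test functionals *)

Section convergence.
Context {R : realType} {d d' : measure_display}.
Context {T : measurableType d} {T' : measurableType d'}.
Variables (P : probability T R) (L : T -> R * R * R * R -> R).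
Variables (P' : probability T' R) (Lper : T' -> R * R * R * R -> R).
Hypothesis HL : is_directed_landscape P L.
Hypothesis HLper : is_periodic_landscape P L P' Lper.

Let X (e : R) (w : T') (p : R * R) : \bar R :=
  ((e `^ (- (1 / 3)))%R%:E *
     periodic_kpz_fixed_point (@periodic_narrow_wedge R) (Lper w)
       (p.1 * e `^ (2 / 3))%R (p.2 * e)%R)%E.

Let Y (w : T) (p : R * R) : \bar R :=
  kpz_fixed_point (@narrow_wedge R) (L w) p.1 p.2.

Let random_field_X (e : R) : 0 < e -> random_field (@upper_half R) (X e).
Proof.
have [[[rL _] _] _ _ _ _] := HLper.
move=> e0 [y t] _.
apply: (@eq_measurable_fun _ _ _ _ _ (fun w =>
  if 0 < t then (e `^ (- (1 / 3)) * Lper w (0, 0, y * e `^ (2 / 3), t * e))%:E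
  else ((e `^ (- (1 / 3)))%:E * periodic_narrow_wedge (y * e `^ (2 / 3))%R)%E)).
  move=> w _; rewrite /X /= periodic_narrow_wedge_fixed_point pmulr_lgt0//.
  by case: ifP.
have [t0|_] := ltP 0 t; last exact: measurable_cst.
apply/measurable_EFinP; apply: measurable_funM => //.
by apply: rL; rewrite /R4up /= mulr_gt0.
Qed.

Let path_laws_close : exists r C : R, [/\ 0 < r, 0 < C &
  forall e A, 0 < e -> path_sigma (scaled_box r (e `^ (1 / 3))) A ->
    (P' (X e @^-1` A) <= P (Y @^-1` A) + (C * e `^ (1 / 3))%:E)%E].
Proof.
have [[[rL _] _] [_ _ [r [alpha [C [/andP[r0 r1] alpha2 C0 tv]]]] _ _] _ _ _] :=
  HLper.
have [[rL0 _] _ _ _] := HL.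
exists r, (C + 1); split=> //; first exact: addr_gt0.
move=> e A e0 sA; set c := e `^ (1 / 3).
have c0 : 0 < c by rewrite powR_gt0.
have sAup : path_sigma (@upper_half R) A by apply: path_sigmaS sA => p [].
have mX : measurable (X e @^-1` A).
  exact: (random_field_measurable (random_field_X e0)).
(* The total variation bound concerns windows of length at most 1. For larger [c] the bound exceeds
   1, because the constant is [C + 1] rather than [C]. *)
have [c1|c1] := leP c 1; last first.
  apply: (le_trans (probability_le1 _ mX)).
  apply: (@le_trans _ _ ((C + 1) * c)%:E); last by rewrite leeDr.
  by rewrite lee_fin (le_trans (ltW c1))// ler_peMl ?(ltW c0)// lerDr ltW.
have -> : P (Y @^-1` A) = P ((wedge_path c \o L) @^-1` A).
  rewrite -(eq_law_rescaled_narrow_wedge c0 HL sAup).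
  congr (P _); apply/seteqP; split=> w /=;
    by congr (A _); apply/funext => p; rewrite /= kpz_rescaledE.
(* The two paths agree only on the box, which suffices since [A] depends on no other coordinates. *)
have -> : X e @^-1` A = (wedge_path c \o Lper) @^-1` A.
  apply/funext => w; apply/propext; apply: path_sigma_saturated sA _ => p pK.
  by rewrite /X /= (@periodic_kpz_rescaledE _ _ r).
pose W := window (- (r / 2)) r 0 c.
have sW : path_sigma W (wedge_path c @^-1` A).
  apply: path_sigma_comp sA => p B pK mB.
  exact: wedge_path_measurable.
have WR4 : W `<=` @R4up R by move=> p [].
have m1 : measurable ((wedge_path c \o Lper) @^-1` A).
  rewrite comp_preimage; apply: (random_field_measurable rL).
  exact: path_sigmaS sW.
have m2 : measurable ((wedge_path c \o L) @^-1` A).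
  rewrite comp_preimage; apply: (random_field_measurable rL0).
  exact: path_sigmaS sW.
have tvA : (`|P' ((wedge_path c \o Lper) @^-1` A) -
    P ((wedge_path c \o L) @^-1` A)| <= (C * c `^ alpha)%:E)%E.
  (* The window is the arc of length [r] centred at 0, over the times from 0 to [c]. *)
  apply: le_trans (tv c (- (r / 2)) 0 _ _); last 2 first.
  - by rewrite c0.
  - by rewrite lexx subr_ge0.
  by apply: ereal_sup_ubound; exists (wedge_path c @^-1` A).
have ca : c `^ alpha <= c.
  rewrite -[leRHS](powRr1 (ltW c0)); apply: ger_powR; last by lra.
  by rewrite c0.
apply: (@le_trans _ _ (P ((wedge_path c \o L) @^-1` A) + (C * c `^ alpha)%:E)%E).
  rewrite -leeBlDl ?fin_num_measure//.
  exact: le_trans (lee_abs _) tvA.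
rewrite leeD2l// lee_fin mulrDl mul1r.
apply: (@le_trans _ _ (C * c)); first by rewrite ler_pM2l.
by rewrite lerDl ltW.
Qed.

Lemma limsup_test_functional (F : path_space R -> R) (M : R) (e : nat -> R) :
  continuous F -> (forall f, `|F f| <= M) ->
  (forall B : set R, measurable B ->
    path_sigma (@upper_half R) (F @^-1` B : set (R * R -> \bar R))) ->
  (forall n, 0 < e n) -> e n @[n --> \oo] --> (0 : R) ->
  forall eta : R, 0 < eta -> \forall n \near \oo,
    ('E_P'[fun w => F (X (e n) w)] <= 'E_P[fun w => F (Y w)] + eta%:E)%E.
Proof.
move=> cF FM mF e0 ecv.
have [r [C [r0 C0 close]]] := path_laws_close.
pose c n := e n `^ (1 / 3).
have ccv : c n @[n --> \oo] --> (0 : R).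
  have /cvg_at_rightP/(_ e) := @powR_cvg0 R (1 / 3) ltac:(lra).
  by apply; split.
have rY : random_field (@upper_half R) Y.
  by apply: narrow_wedge_random_field; case: HL.
have mFX (d0 : measure_display) (T0 : measurableType d0) (Z : T0 -> R * R -> \bar R) :
    random_field (@upper_half R) Z -> measurable_fun setT (fun w => F (Z w)).
  move=> rZ _ B mB; rewrite setTI.
  exact: (random_field_measurable rZ (mF _ mB)).
apply: (@limsup_expectation _ _ _ _ _ P P' M) => //.
- by move=> n; apply: mFX; exact: random_field_X.
- exact: mFX.
move=> a.
apply: (@limsup_law_closed _ _ (@upper_half R) _ _ _ _ P P' Y (fun n => X (e n))
  (fun n => scaled_box r (c n)) (fun n => C * c n) [set f | a <= F f]) => //.
- by move=> n; exact: random_field_X.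
- by move=> n p [].
- rewrite -[X in _ --> X](mulr0 C).
  by apply: (@cvgM R^o); first exact: cvg_cst.
- by move=> n A sA; exact: close.
- have := mF `[a, +oo[%classic (measurable_itv _).
  by congr (path_sigma _ _); apply/seteqP; split=> f /=; rewrite in_itv /= andbT.
(* The boxes exhaust the half-plane, so [g n] tends to [f]. If [F f] were below [a], continuity
   would keep [F (g n)] below [a] from some rank on, against membership in the superlevel set
   infinitely often. *)
move=> f g gf Bg; rewrite /= leNgt; apply/negP => Fa.
have gcv : (g : nat -> path_space R) n @[n --> \oo] --> (f : path_space R).
  apply: path_space_cvg gf => A cA Aup.
  exact: compact_scaled_box.
have Fcv : F (g n) @[n --> \oo] --> F f by apply: cvg_comp gcv _; exact: cF.
have [N _ HN] : \forall n \near \oo, F (g n) < a by exact: (cvgr_lt _ Fcv).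
have [n Nn] := Bg N.
by rewrite /= leNgt HN.
Qed.

Lemma expectation_test_functional_cvg (F : path_space R -> R) (M : R) :
  continuous F -> (forall f, `|F f| <= M) ->
  (forall B : set R, measurable B ->
    path_sigma (@upper_half R) (F @^-1` B : set (R * R -> \bar R))) ->
  'E_P'[fun w => F (X e w)]%E @[e --> 0^'+] --> 'E_P[fun w => F (Y w)]%E.
Proof.
move=> cF FM mF.
have LfunF (d0 : measure_display) (T0 : measurableType d0) (P0 : probability T0 R)
    (Z : T0 -> R * R -> \bar R) :
    random_field (@upper_half R) Z -> (fun w => F (Z w)) \in Lfun P0 1.
  move=> rZ; apply: (@bounded_Lfun1 _ _ _ _ M) => // _ B mB; rewrite setTI.
  exact: (random_field_measurable rZ (mF _ mB)).
have expectationN (d0 : measure_display) (T0 : measurableType d0)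
    (P0 : probability T0 R) (g : T0 -> R) : g \in Lfun P0 1 ->
    'E_P0[fun w => (- g w)%R]%E = (- 'E_P0[g])%E.
  move=> gL; rewrite -mulN1e -EFinN -expectationZl//; congr expectation.
  by apply/funext => w /=; rewrite mulrN1.
have LY : (fun w => F (Y w)) \in Lfun P 1.
  by apply: LfunF; apply: narrow_wedge_random_field; case: HL.
rewrite -[X in _ --> X]fineK; last exact: expectation_fin_num.
(* Passing to sequences makes the limsup events countable unions and intersections. *)
apply/cvge_at_rightP => e [e0 ecv].
have LX n : (fun w => F (X (e n) w)) \in Lfun P' 1.
  by apply: LfunF; exact: random_field_X.
apply/fine_cvgP; split; first by apply: nearW => n; exact: expectation_fin_num.
apply/cvgrPdist_le => eta eta0.
have up := limsup_test_functional cF FM mF e0 ecv eta0.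
(* The functional - F is again an admissible test functional, and its upper bound is the lower bound
   for [F]. *)
have lo : \forall n \near \oo, ('E_P'[fun w => (- F (X (e n) w))%R] <=
    'E_P[fun w => (- F (Y w))%R] + eta%:E)%E.
  apply: (@limsup_test_functional (fun f => - F f) M) => //.
  - exact: continuous_oppr_comp.
  - by move=> f; rewrite normrN.
  - move=> B mB; apply: (mF (-%R @^-1` B)).
    by rewrite -[X in measurable X]setTI; exact: oppr_measurable.
apply: filterS2 up lo => n.
rewrite !expectationN// -(fineK (expectation_fin_num (LX n))).
rewrite -(fineK (expectation_fin_num LY)) -!EFinN -!EFinD !lee_fin /= => h1 h2.
by rewrite ler_norml; apply/andP; split; lra.
Qed.

End convergence.

Unset Implicit Arguments.
Set Strict Implicit.
Set Printing Implicit Defensive.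

Theorem corollary4p11 (R : realType) (d d' : measure_display)
    (T : measurableType d) (P : probability T R)
    (L : T -> R * R * R * R -> R)
    (T' : measurableType d') (P' : probability T' R)
    (Lper : T' -> R * R * R * R -> R)
    (HL : is_directed_landscape P L)
    (HLper : is_periodic_landscape P L P' Lper) :
  cvg_in_distribution
    P' (fun (e : R) (w : T') (p : R * R) =>
          ((e `^ (- (1 / 3)))%R%:E *
           periodic_kpz_fixed_point (@periodic_narrow_wedge R) (Lper w)
             (p.1 * e `^ (2 / 3))%R (p.2 * e)%R)%E)
    P (fun (w : T) (p : R * R) =>
         kpz_fixed_point (@narrow_wedge R) (L w) p.1 p.2).
Proof.
by move=> F cF [M FM] mF; exact: expectation_test_functional_cvg FM mF.
Qed.
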